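(* Let $k$ be an algebraically closed field of characteristic $0$. Let $H$ be a finite dimensional non-cosemisimple Hopf algebra over $k$ such that, as coalgebras, $H_0 \cong k[G] \oplus \mathcal{M}^c(n_1,k) \oplus \cdots \oplus \mathcal{M}^c(n_t,k)$, where $G=G(H)$, $t$ is a positive integer and $2 \leq n_1 \leq n_2 \leq \cdots \leq n_t$, and such that $H$ has no nontrivial skew primitive elements. Then $$\dim H > \dim H_1 = \dim H_0 + \dim P_1 \geq (1 + 2n_1)|G| + \sum_{i=1}^t n_i^2.$$
   Context: $G(H)$ is the group of grouplike elements of $H$. $H_0$ is the coradical of $H$ and $H_0\subseteq H_1\subseteq\cdots$ is the coradical filtration. $\mathcal{M}^c(n,k)$ is the $n\times n$ matrix coalgebra: it has a basis $\{e_{ij}\mid 1\le i,j\le n\}$ with $\Delta(e_{ij})=\sum_{r=1}^n e_{ir}\otimes e_{rj}$ and $\epsilon(e_{ij})=\delta_{ij}$. A skew primitive element is an $x\in H$ with $\Delta(x)=g\otimes x+x\otimes h$ for some $g,h\in G(H)$; it is nontrivial if $x\notin k[G(H)]$. Definition of $P_1$: over an algebraically closed field there is a coalgebra projection $\pi:H\to H_0$ (a coalgebra map restricting to the identity on $H_0$); fix one, with kernel $I$. Put $\rho_L=(\pi\otimes \mathrm{id})\Delta:H\to H_0\otimes H$ and $\rho_R=(\mathrm{id}\otimes\pi)\Delta:H\to H\otimes H_0$, and let $$P_1=\{x\in H:\Delta(x)=\rho_L(x)+\rho_R(x)\}=\Delta^{-1}(H_0\otimes I+I\otimes H_0).$$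 *)

(* Defs.v *)
From HB Require Import structures.
From mathcomp Require Import all_boot all_algebra falgebra.
From mathcomp Require Import finmap.
From mathcomp Require Import boolp classical_sets functions cardinality.

Set Implicit Arguments.
Unset Strict Implicit.
Unset Printing Implicit Defensive.

Import GRing.Theory.
Local Open Scope ring_scope.

(* An element of U ⊗ V is encoded by the matrix of its coordinates in the basis
   (e_i ⊗ f_j), where (e_i) and (f_j) are the bases [vbasis fullv] of U and V.
   The universal property is [tlift_tensor] together with [tens_ext].
   When A is an algebra, the product of A ⊗ A is [tens_mul] below; it has
   nothing to do with the matrix product that [tens A A] unfolds to. *)

Definition tens (K : fieldType) (U V : vectType K) : Type :=
  'M[K]_(\dim {:U}, \dim {:V}).

HB.instance Definition _ (K : fieldType) (U V : vectType K) :=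
  Vector.on (tens U V).

Definition tensor (K : fieldType) (U V : vectType K) (x : U) (y : V) :
    tens U V :=
  \matrix_(i, j) (coord (vbasis fullv) i x * coord (vbasis fullv) j y).

Notation "x ⊗ y" := (tensor x y) (at level 40, left associativity).

Section Tensor.
Variable K : fieldType.
Implicit Types U V W Z : vectType K.

Lemma tensorDl U V (x x' : U) (y : V) : (x + x') ⊗ y = x ⊗ y + x' ⊗ y.
Proof. by apply/matrixP=> i j; rewrite !mxE linearD mulrDl. Qed.

Lemma tensorDr U V (x : U) (y y' : V) : x ⊗ (y + y') = x ⊗ y + x ⊗ y'.
Proof. by apply/matrixP=> i j; rewrite !mxE linearD mulrDr. Qed.

Lemma tensorZl U V a (x : U) (y : V) : (a *: x) ⊗ y = a *: (x ⊗ y).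
Proof. by apply/matrixP=> i j; rewrite !mxE linearZ mulrA. Qed.

Lemma tensorZr U V a (x : U) (y : V) : x ⊗ (a *: y) = a *: (x ⊗ y).
Proof. by apply/matrixP=> i j; rewrite !mxE linearZ mulrCA. Qed.

Lemma tensor_suml U V I (r : seq I) (P : pred I) (F : I -> U) (y : V) :
  (\sum_(i <- r | P i) F i) ⊗ y = \sum_(i <- r | P i) F i ⊗ y.
Proof.
apply: (big_morph (fun x => x ⊗ y)) => [x x'|]; first exact: tensorDl.
by rewrite -(scale0r 0) tensorZl scale0r.
Qed.

Lemma tensor_sumr U V I (r : seq I) (P : pred I) (x : U) (F : I -> V) :
  x ⊗ (\sum_(i <- r | P i) F i) = \sum_(i <- r | P i) x ⊗ F i.
Proof.
apply: (big_morph (fun y => x ⊗ y)) => [y y'|]; first exact: tensorDr.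
by rewrite -(scale0r 0) tensorZr scale0r.
Qed.

Definition bilin U V W (B : U -> V -> W) : Prop :=
  (forall y, linear (B ^~ y)) /\ (forall x, linear (B x)).

Definition tlift_fun U V W (B : U -> V -> W) (M : tens U V) : W :=
  \sum_i \sum_j M i j *: B (vbasis fullv)`_i (vbasis fullv)`_j.

Fact tlift_is_linear U V W (B : U -> V -> W) : linear (tlift_fun B).
Proof.
move=> a M N; rewrite /tlift_fun scaler_sumr -big_split; apply: eq_bigr => i _.
rewrite scaler_sumr -big_split; apply: eq_bigr => j _.
by rewrite !mxE scalerDl scalerA.
Qed.
HB.instance Definition _ U V W (B : U -> V -> W) :=
  GRing.isLinear.Build K (tens U V) W _ (tlift_fun B) (tlift_is_linear B).

Definition tlift U V W (B : U -> V -> W) : 'Hom(tens U V, W) :=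
  linfun (tlift_fun B).

Lemma tlift_tensor U V W (B : U -> V -> W) x y :
  bilin B -> tlift B (x ⊗ y) = B x y.
Proof.
move=> [Bl Br]; rewrite lfunE /= /tlift_fun.
pose BlL y : {linear U -> W} :=
  HB.pack (B ^~ y) (GRing.isLinear.Build K U W _ (B ^~ y) (Bl y)).
pose BrL x : {linear V -> W} :=
  HB.pack (B x) (GRing.isLinear.Build K V W _ (B x) (Br x)).
rewrite [in RHS](coord_vbasis (memvf x)) -[RHS]/(BlL y _) linear_sum.
apply: eq_bigr => i _; rewrite [RHS]linearZ /=.
have -> z : B z y = \sum_j coord (vbasis fullv) j y *: B z (vbasis fullv)`_j.
  rewrite {1}(coord_vbasis (memvf y)) -[LHS]/(BrL z _) linear_sum.
  by apply: eq_bigr => j _; rewrite linearZ.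
by rewrite scaler_sumr; apply: eq_bigr => j _; rewrite mxE scalerA.
Qed.

Lemma tensor_basis U V (M : tens U V) :
  M = \sum_i \sum_j M i j *: ((vbasis fullv)`_i ⊗ (vbasis fullv)`_j).
Proof.
apply/matrixP=> k l; rewrite summxE (bigD1 k) //= summxE (bigD1 l) //=.
have fU := basis_free (vbasisP {:U}); have fV := basis_free (vbasisP {:V}).
rewrite !mxE !coord_free // !eqxx !mulr1 big1 ?addr0 => [|j jl]; last first.
  by rewrite !mxE !coord_free // (negPf jl) !mulr0.
rewrite big1 ?addr0 // => i ik; rewrite summxE big1 // => j _.
by rewrite !mxE !coord_free // (negPf ik) mul0r mulr0.
Qed.

Lemma tens_ext U V W (f g : 'Hom(tens U V, W)) :
  (forall x y, f (x ⊗ y) = g (x ⊗ y)) -> f = g.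
Proof.
move=> fg; apply/lfunP=> M; rewrite [M]tensor_basis !linear_sum.
apply: eq_bigr => i _; rewrite !linear_sum; apply: eq_bigr => j _.
by rewrite !linearZ /= fg.
Qed.

Lemma tensor_bilin U V : bilin (@tensor K U V).
Proof.
by split=> z a x y; rewrite ?tensorDl ?tensorZl // ?tensorDr ?tensorZr.
Qed.

Lemma counitl_bilin V (f : 'Hom(V, K^o)) :
  bilin (fun a b : V => (f a : K) *: b).
Proof.
split=> z a x y /=; first by rewrite linearP scalerDl -scalerA.
by rewrite scalerDr !scalerA mulrC.
Qed.

Lemma counitr_bilin V (f : 'Hom(V, K^o)) :
  bilin (fun a b : V => (f b : K) *: a).
Proof.
split=> z a x y /=; last by rewrite linearP scalerDl -scalerA.
by rewrite scalerDr !scalerA mulrC.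
Qed.

Definition tmap U V U' V' (f : 'Hom(U, U')) (g : 'Hom(V, V')) :
    'Hom(tens U V, tens U' V') :=
  tlift (fun x y => f x ⊗ g y).

Lemma tmapE U V U' V' (f : 'Hom(U, U')) (g : 'Hom(V, V')) x y :
  tmap f g (x ⊗ y) = f x ⊗ g y.
Proof.
by rewrite tlift_tensor //; split=> z a u v /=;
   rewrite linearP ?tensorDl ?tensorZl // ?tensorDr ?tensorZr.
Qed.

Lemma tmap_comp U V U' V' U'' V'' (f' : 'Hom(U', U'')) (g' : 'Hom(V', V''))
    (f : 'Hom(U, U')) (g : 'Hom(V, V')) t :
  tmap f' g' (tmap f g t) = tmap (f' \o f) (g' \o g) t.
Proof.
have -> : tmap (f' \o f) (g' \o g) = (tmap f' g' \o tmap f g)%VF.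
  by apply: tens_ext => x y; rewrite comp_lfunE !tmapE !comp_lfunE.
by rewrite comp_lfunE.
Qed.

Lemma tmap1 U V (t : tens U V) : tmap \1 \1 t = t.
Proof.
have -> : tmap \1 \1 = \1%VF :> 'End(tens U V).
  by apply: tens_ext => x y; rewrite tmapE !id_lfunE.
by rewrite id_lfunE.
Qed.

Definition tassoc U V W : 'Hom(tens (tens U V) W, tens U (tens V W)) :=
  tlift (fun t w => tlift (fun u v => u ⊗ (v ⊗ w)) t).

Lemma tassocE U V W (u : U) (v : V) (w : W) :
  tassoc U V W ((u ⊗ v) ⊗ w) = u ⊗ (v ⊗ w).
Proof.
have B w' : bilin (fun (u : U) (v : V) => u ⊗ (v ⊗ (w' : W))).
  by split=> z a x y;
    rewrite ?tensorDl ?tensorZl // ?tensorDr ?tensorZr.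
rewrite tlift_tensor ?tlift_tensor //; split=> [y|x] a s t /=.
  exact: linearP.
rewrite !lfunE /= /tlift_fun scaler_sumr -big_split; apply: eq_bigr => i _.
rewrite scaler_sumr -big_split; apply: eq_bigr => j _.
by rewrite !tensorDr !tensorZr scalerDr !scalerA mulrC.
Qed.

Lemma tens_ext3 U V W Z (f g : 'Hom(tens (tens U V) W, Z)) :
  (forall u v w, f (u ⊗ v ⊗ w) = g (u ⊗ v ⊗ w)) -> f = g.
Proof.
move=> fg; apply: tens_ext => s w; rewrite [s]tensor_basis !tensor_suml.
rewrite !linear_sum; apply: eq_bigr => i _.
rewrite !tensor_suml !linear_sum; apply: eq_bigr => j _.
by rewrite !tensorZl !linearZ /= fg.
Qed.

Lemma tassoc_tmap U V W U' V' W' (f : 'Hom(U, U')) (g : 'Hom(V, V'))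
    (h : 'Hom(W, W')) t :
  tassoc U' V' W' (tmap (tmap f g) h t) =
  tmap f (tmap g h) (tassoc U V W t).
Proof.
rewrite -[LHS]comp_lfunE -[RHS]comp_lfunE; move: t; apply/lfunP.
by apply: tens_ext3 => u v w; rewrite !comp_lfunE !tmapE !tassocE !tmapE.
Qed.

Lemma counitl_tmap U V (f : 'Hom(U, V)) (e : 'Hom(V, K^o)) t :
  tlift (fun a b : V => (e a : K) *: b) (tmap f f t) =
  f (tlift (fun a b : U => ((e \o f)%VF a : K) *: b) t).
Proof.
rewrite -[LHS]comp_lfunE -[RHS]comp_lfunE; move: t; apply/lfunP.
apply: tens_ext => x y; rewrite !comp_lfunE tmapE.
rewrite tlift_tensor; last exact: counitl_bilin.
rewrite tlift_tensor; last exact: counitl_bilin.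
by rewrite linearZ /= comp_lfunE.
Qed.

Lemma counitr_tmap U V (f : 'Hom(U, V)) (e : 'Hom(V, K^o)) t :
  tlift (fun a b : V => (e b : K) *: a) (tmap f f t) =
  f (tlift (fun a b : U => ((e \o f)%VF b : K) *: a) t).
Proof.
rewrite -[LHS]comp_lfunE -[RHS]comp_lfunE; move: t; apply/lfunP.
apply: tens_ext => x y; rewrite !comp_lfunE tmapE.
rewrite tlift_tensor; last exact: counitr_bilin.
rewrite tlift_tensor; last exact: counitr_bilin.
by rewrite linearZ /= comp_lfunE.
Qed.

Definition tensv U V (A : {vspace U}) (B : {vspace V}) : {vspace tens U V} :=
  <<[seq x ⊗ y | x <- vbasis A, y <- vbasis B]>>%VS.

Lemma mem_tensv U V (A : {vspace U}) (B : {vspace V}) x y :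
  x \in A -> y \in B -> x ⊗ y \in tensv A B.
Proof.
move=> xA yB; rewrite (coord_vbasis xA) (coord_vbasis yB) tensor_suml.
apply: rpred_sum => i _; rewrite tensor_sumr; apply: rpred_sum => j _.
rewrite tensorZl tensorZr !rpredZ // memv_span //.
by apply/allpairsP; exists ((vbasis A)`_i, (vbasis B)`_j);
   rewrite /= !mem_nth ?size_tuple.
Qed.

Lemma tensvP U V (A : {vspace U}) (B : {vspace V}) (W : {vspace tens U V}) :
  (forall x y, x \in A -> y \in B -> x ⊗ y \in W) -> (tensv A B <= W)%VS.
Proof.
move=> sW; apply/span_subvP => _ /allpairsP[[x y] /= [xA yB ->]].
by apply: sW; apply: vbasis_mem.
Qed.

Lemma tensvS U V (A A' : {vspace U}) (B B' : {vspace V}) :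
  (A <= A')%VS -> (B <= B')%VS -> (tensv A B <= tensv A' B')%VS.
Proof.
by move=> /subvP sA /subvP sB; apply: tensvP => x y /sA ? /sB ?;
   apply: mem_tensv.
Qed.

End Tensor.

HB.mixin Record Vector_isCoalgebra (K : fieldType) C of Vector K C := {
  comul : 'Hom(C, tens C C);
  counit : 'Hom(C, K^o);
  comulA : forall x : C,
    tassoc C C C (tmap comul \1 (comul x)) = tmap \1 comul (comul x);
  counitl : forall x : C,
    tlift (fun a b : C => (counit a : K) *: b) (comul x) = x;
  counitr : forall x : C,
    tlift (fun a b : C => (counit b : K) *: a) (comul x) = x
}.

#[short(type="coalgType")]
HB.structure Definition Coalgebra (K : fieldType) :=
  { C of Vector_isCoalgebra K C & Vector K C }.

Arguments comul {K s}.
Arguments counit {K s}.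

Section Pushforward.
Variables (K : fieldType) (C : coalgType K) (V : vectType K) (f : 'Hom(C, V)).

Lemma comulA_push (d : 'Hom(V, tens V V)) x :
    (forall u, d (f u) = tmap f f (comul u)) ->
  tassoc V V V (tmap d \1 (d (f x))) = tmap \1 d (d (f x)).
Proof.
move=> df; rewrite df !tmap_comp !comp_lfun1l.
have -> : (d \o f = tmap f f \o comul)%VF.
  by apply/lfunP => u; rewrite !comp_lfunE df.
rewrite -[f in tmap _ f]comp_lfun1r -tmap_comp tassoc_tmap comulA tmap_comp.
by rewrite comp_lfun1r.
Qed.

Lemma counitl_push (d : 'Hom(V, tens V V)) (e : 'Hom(V, K^o)) x :
    (forall u, d (f u) = tmap f f (comul u)) ->
    (forall u, e (f u) = counit u) ->
  tlift (fun a b : V => (e a : K) *: b) (d (f x)) = f x.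
Proof.
move=> df ef; rewrite df counitl_tmap -[in RHS](counitl x).
suff -> : (e \o f)%VF = counit by [].
by apply/lfunP => u; rewrite comp_lfunE ef.
Qed.

Lemma counitr_push (d : 'Hom(V, tens V V)) (e : 'Hom(V, K^o)) x :
    (forall u, d (f u) = tmap f f (comul u)) ->
    (forall u, e (f u) = counit u) ->
  tlift (fun a b : V => (e b : K) *: a) (d (f x)) = f x.
Proof.
move=> df ef; rewrite df counitr_tmap -[in RHS](counitr x).
suff -> : (e \o f)%VF = counit by [].
by apply/lfunP => u; rewrite comp_lfunE ef.
Qed.

End Pushforward.

Definition coalg_hom (K : fieldType) (C D : coalgType K) (f : 'Hom(C, D)) :=
  (forall x, comul (f x) = tmap f f (comul x)) /\
  (forall x, counit (f x) = counit x).

Definition coalg_iso (K : fieldType) (C D : coalgType K) : Prop :=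
  exists f : 'Hom(C, D), coalg_hom f /\ bijective f.

Definition tens_mul (K : fieldType) (A : falgType K) (s t : tens A A) :
    tens A A :=
  tlift (fun a b : A => tlift (fun c d : A => (a * c) ⊗ (b * d)) t) s.

Definition mulmap (K : fieldType) (A : falgType K) : 'Hom(tens A A, A) :=
  tlift (fun a b : A => a * b).

HB.mixin Record isHopf (K : fieldType) H of Falgebra K H & Coalgebra K H := {
  antipode : 'End(H);
  comul1 : comul (1 : H) = 1 ⊗ 1;
  comulM : forall x y : H, comul (x * y) = tens_mul (comul x) (comul y);
  counit1 : counit (1 : H) = 1;
  counitM : forall x y : H, counit (x * y) = counit x * counit y;
  antipodel : forall x : H,
    mulmap H (tmap antipode \1 (comul x)) = (counit x : K)%:A;
  antipoder : forall x : H,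
    mulmap H (tmap \1 antipode (comul x)) = (counit x : K)%:A
}.

#[short(type="hopfType")]
HB.structure Definition Hopf (K : fieldType) :=
  { H of isHopf K H & Falgebra K H & Coalgebra K H }.

(* The matrix coalgebra M^c(n, K), with e_ij = delta_mx i j. *)
Definition mxcoalg (K : fieldType) (n : nat) : Type := 'M[K]_n.

HB.instance Definition _ (K : fieldType) n := Vector.on (mxcoalg K n).

Section MatrixCoalgebra.
Variables (K : fieldType) (n : nat).
Local Notation e i j := (delta_mx i j : mxcoalg K n).

Definition mxcoalg_comul_fun (A : mxcoalg K n) :
    tens (mxcoalg K n) (mxcoalg K n) :=
  \sum_i \sum_j A i j *: \sum_r (e i r ⊗ e r j).

Fact mxcoalg_comul_linear : linear mxcoalg_comul_fun.
Proof.
move=> a A B; rewrite /mxcoalg_comul_fun scaler_sumr -big_split.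
apply: eq_bigr => i _; rewrite scaler_sumr -big_split.
by apply: eq_bigr => j _; rewrite !mxE scalerDl scalerA.
Qed.
HB.instance Definition _ :=
  GRing.isLinear.Build K (mxcoalg K n) _ _ _ mxcoalg_comul_linear.

Definition mxcoalg_comul := linfun mxcoalg_comul_fun.

Definition mxcoalg_counit_fun (A : mxcoalg K n) : K^o := \tr A.

Fact mxcoalg_counit_linear : linear mxcoalg_counit_fun.
Proof. by move=> a A B; rewrite /mxcoalg_counit_fun linearP. Qed.
HB.instance Definition _ :=
  GRing.isLinear.Build K (mxcoalg K n) _ _ _ mxcoalg_counit_linear.

Definition mxcoalg_counit := linfun mxcoalg_counit_fun.

Lemma mxcoalg_comulE i j : mxcoalg_comul (e i j) = \sum_r e i r ⊗ e r j.
Proof.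
rewrite lfunE /= /mxcoalg_comul_fun (bigD1 i) //= (bigD1 j) //=.
rewrite mxE !eqxx scale1r [X in _ + X + _]big1 ?addr0 => [|l lj]; last first.
  by rewrite mxE (negPf lj) andbF scale0r.
rewrite [X in _ + X]big1 ?addr0 // => k ki; apply: big1 => l _.
by rewrite mxE (negPf ki) scale0r.
Qed.

Lemma mxcoalg_counitE i j : mxcoalg_counit (e i j) = (i == j)%:R.
Proof.
rewrite lfunE /= /mxcoalg_counit_fun /mxtrace (bigD1 i) //= mxE eqxx /=.
by rewrite big1 ?addr0 // => k ki; rewrite mxE (negPf ki).
Qed.

Lemma mxcoalg_ext (V : vectType K) (f g : 'Hom(mxcoalg K n, V)) :
  (forall i j, f (e i j) = g (e i j)) -> f = g.
Proof.
move=> fg; apply/lfunP=> A; rewrite (matrix_sum_delta A) !linear_sum.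
apply: eq_bigr => i _; rewrite !linear_sum; apply: eq_bigr => j _.
by rewrite !linearZ /= fg.
Qed.

Fact mxcoalg_comulA (x : mxcoalg K n) :
  tassoc _ _ _ (tmap mxcoalg_comul \1 (mxcoalg_comul x)) =
  tmap \1 mxcoalg_comul (mxcoalg_comul x).
Proof.
rewrite -[LHS]comp_lfunE -[LHS]comp_lfunE -[RHS]comp_lfunE.
move: x; apply/lfunP; apply: mxcoalg_ext => i j.
rewrite !comp_lfunE !mxcoalg_comulE !linear_sum /=.
under eq_bigr do rewrite tmapE id_lfunE mxcoalg_comulE tensor_suml linear_sum.
under [RHS]eq_bigr do rewrite tmapE id_lfunE mxcoalg_comulE tensor_sumr.
rewrite exchange_big; apply: eq_bigr => r _; apply: eq_bigr => s _.
by rewrite /= tassocE.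
Qed.

Fact mxcoalg_counitl (x : mxcoalg K n) :
  tlift (fun a b : mxcoalg K n => (mxcoalg_counit a : K) *: b) (mxcoalg_comul x)
  = x.
Proof.
rewrite -[LHS]comp_lfunE -[RHS]id_lfunE.
move: x; apply/lfunP; apply: mxcoalg_ext => i j.
rewrite comp_lfunE id_lfunE mxcoalg_comulE linear_sum (bigD1 i) //=.
rewrite tlift_tensor; last exact: counitl_bilin.
rewrite mxcoalg_counitE eqxx scale1r big1 ?addr0 // => r ri.
rewrite tlift_tensor; last exact: counitl_bilin.
by rewrite mxcoalg_counitE eq_sym (negPf ri) scale0r.
Qed.

Fact mxcoalg_counitr (x : mxcoalg K n) :
  tlift (fun a b : mxcoalg K n => (mxcoalg_counit b : K) *: a) (mxcoalg_comul x)
  = x.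
Proof.
rewrite -[LHS]comp_lfunE -[RHS]id_lfunE.
move: x; apply/lfunP; apply: mxcoalg_ext => i j.
rewrite comp_lfunE id_lfunE mxcoalg_comulE linear_sum (bigD1 j) //=.
rewrite tlift_tensor; last exact: counitr_bilin.
rewrite mxcoalg_counitE eqxx scale1r big1 ?addr0 // => r rj.
rewrite tlift_tensor; last exact: counitr_bilin.
by rewrite mxcoalg_counitE (negPf rj) scale0r.
Qed.

HB.instance Definition _ := Vector_isCoalgebra.Build K (mxcoalg K n)
  mxcoalg_comulA mxcoalg_counitl mxcoalg_counitr.

End MatrixCoalgebra.

(* The coalgebra k[T] in which the elements of T are grouplike; t in T is
   encoded by its indicator function [grpcoalg_elt t]. *)
Definition grpcoalg (K : fieldType) (T : finType) : Type := {ffun T -> K^o}.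

HB.instance Definition _ (K : fieldType) (T : finType) :=
  Vector.on (grpcoalg K T).

Section GrouplikeCoalgebra.
Variables (K : fieldType) (T : finType).

Definition grpcoalg_elt (g : T) : grpcoalg K T := [ffun h => (h == g)%:R].
Local Notation e := grpcoalg_elt.

Definition grpcoalg_comul_fun (x : grpcoalg K T) :
    tens (grpcoalg K T) (grpcoalg K T) :=
  \sum_g x g *: (e g ⊗ e g).

Fact grpcoalg_comul_linear : linear grpcoalg_comul_fun.
Proof.
move=> a x y; rewrite /grpcoalg_comul_fun scaler_sumr -big_split.
by apply: eq_bigr => g _; rewrite !ffunE scalerDl scalerA.
Qed.
HB.instance Definition _ :=
  GRing.isLinear.Build K (grpcoalg K T) _ _ _ grpcoalg_comul_linear.

Definition grpcoalg_comul := linfun grpcoalg_comul_fun.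

Definition grpcoalg_counit_fun (x : grpcoalg K T) : K^o := \sum_g x g.

Fact grpcoalg_counit_linear : linear grpcoalg_counit_fun.
Proof.
move=> a x y; rewrite /grpcoalg_counit_fun scaler_sumr -big_split.
by apply: eq_bigr => g _; rewrite !ffunE.
Qed.
HB.instance Definition _ :=
  GRing.isLinear.Build K (grpcoalg K T) _ _ _ grpcoalg_counit_linear.

Definition grpcoalg_counit := linfun grpcoalg_counit_fun.

Lemma grpcoalg_comulE g : grpcoalg_comul (e g) = e g ⊗ e g.
Proof.
rewrite lfunE /= /grpcoalg_comul_fun (bigD1 g) //= ffunE eqxx scale1r.
by rewrite big1 ?addr0 // => h hg; rewrite ffunE (negPf hg) scale0r.
Qed.

Lemma grpcoalg_counitE g : grpcoalg_counit (e g) = 1.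
Proof.
rewrite lfunE /= /grpcoalg_counit_fun (bigD1 g) //= ffunE eqxx.
by rewrite big1 ?addr0 // => h hg; rewrite ffunE (negPf hg).
Qed.

Lemma grpcoalg_ext (V : vectType K) (f g : 'Hom(grpcoalg K T, V)) :
  (forall t, f (e t) = g (e t)) -> f = g.
Proof.
move=> fg; apply/lfunP=> x.
have -> : x = \sum_t x t *: e t.
  apply/ffunP=> h; rewrite sum_ffunE (bigD1 h) //= !ffunE eqxx.
  rewrite big1 ?addr0 => [|t th]; first by rewrite [RHS]mulr1.
  by rewrite !ffunE eq_sym (negPf th); apply: mulr0.
by rewrite !linear_sum; apply: eq_bigr => t _; rewrite !linearZ /= fg.
Qed.

Fact grpcoalg_comulA (x : grpcoalg K T) :
  tassoc _ _ _ (tmap grpcoalg_comul \1 (grpcoalg_comul x)) =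
  tmap \1 grpcoalg_comul (grpcoalg_comul x).
Proof.
rewrite -[LHS]comp_lfunE -[LHS]comp_lfunE -[RHS]comp_lfunE.
move: x; apply/lfunP; apply: grpcoalg_ext => t.
by rewrite !comp_lfunE grpcoalg_comulE !tmapE grpcoalg_comulE !id_lfunE tassocE.
Qed.

Fact grpcoalg_counitl (x : grpcoalg K T) :
  tlift (fun a b : grpcoalg K T => (grpcoalg_counit a : K) *: b) (grpcoalg_comul x)
  = x.
Proof.
rewrite -[LHS]comp_lfunE -[RHS]id_lfunE.
move: x; apply/lfunP; apply: grpcoalg_ext => t.
rewrite comp_lfunE id_lfunE grpcoalg_comulE tlift_tensor.
  by rewrite grpcoalg_counitE scale1r.
exact: counitl_bilin.
Qed.

Fact grpcoalg_counitr (x : grpcoalg K T) :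
  tlift (fun a b : grpcoalg K T => (grpcoalg_counit b : K) *: a) (grpcoalg_comul x)
  = x.
Proof.
rewrite -[LHS]comp_lfunE -[RHS]id_lfunE.
move: x; apply/lfunP; apply: grpcoalg_ext => t.
rewrite comp_lfunE id_lfunE grpcoalg_comulE tlift_tensor.
  by rewrite grpcoalg_counitE scale1r.
exact: counitr_bilin.
Qed.

HB.instance Definition _ := Vector_isCoalgebra.Build K (grpcoalg K T)
  grpcoalg_comulA grpcoalg_counitl grpcoalg_counitr.

End GrouplikeCoalgebra.

Definition dsum (K : fieldType) (C D : coalgType K) : Type := (C * D)%type.

HB.instance Definition _ (K : fieldType) (C D : coalgType K) :=
  Vector.on (dsum C D).

Section DirectSum.
Variables (K : fieldType) (C D : coalgType K).
Local Notation CD := (dsum C D).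

Definition dsum_inl_fun (x : C) : CD := (x, 0).
Definition dsum_inr_fun (y : D) : CD := (0, y).
Definition dsum_fst_fun (z : CD) : C := z.1.
Definition dsum_snd_fun (z : CD) : D := z.2.

Fact dsum_inl_linear : linear dsum_inl_fun.
Proof. by move=> a x y; congr pair; rewrite /= scaler0 addr0. Qed.
Fact dsum_inr_linear : linear dsum_inr_fun.
Proof. by move=> a x y; congr pair; rewrite /= scaler0 addr0. Qed.
Fact dsum_fst_linear : linear dsum_fst_fun. Proof. by []. Qed.
Fact dsum_snd_linear : linear dsum_snd_fun. Proof. by []. Qed.
HB.instance Definition _ := GRing.isLinear.Build K C CD _ _ dsum_inl_linear.
HB.instance Definition _ := GRing.isLinear.Build K D CD _ _ dsum_inr_linear.
HB.instance Definition _ := GRing.isLinear.Build K CD C _ _ dsum_fst_linear.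
HB.instance Definition _ := GRing.isLinear.Build K CD D _ _ dsum_snd_linear.

Definition dsum_inl : 'Hom(C, CD) := linfun dsum_inl_fun.
Definition dsum_inr : 'Hom(D, CD) := linfun dsum_inr_fun.
Definition dsum_fst : 'Hom(CD, C) := linfun dsum_fst_fun.
Definition dsum_snd : 'Hom(CD, D) := linfun dsum_snd_fun.

Definition dsum_comul : 'Hom(CD, tens CD CD) :=
  ((tmap dsum_inl dsum_inl \o comul \o dsum_fst)
   + (tmap dsum_inr dsum_inr \o comul \o dsum_snd))%VF.

Definition dsum_counit : 'Hom(CD, K^o) :=
  ((counit \o dsum_fst) + (counit \o dsum_snd))%VF.

Lemma dsum_fstl x : dsum_fst (dsum_inl x) = x. Proof. by rewrite !lfunE. Qed.
Lemma dsum_sndl x : dsum_snd (dsum_inl x) = 0. Proof. by rewrite !lfunE. Qed.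
Lemma dsum_fstr y : dsum_fst (dsum_inr y) = 0. Proof. by rewrite !lfunE. Qed.
Lemma dsum_sndr y : dsum_snd (dsum_inr y) = y. Proof. by rewrite !lfunE. Qed.

Lemma dsum_comull x : dsum_comul (dsum_inl x) = tmap dsum_inl dsum_inl (comul x).
Proof.
by rewrite add_lfunE !comp_lfunE dsum_fstl dsum_sndl !linear0 addr0.
Qed.

Lemma dsum_comulr y : dsum_comul (dsum_inr y) = tmap dsum_inr dsum_inr (comul y).
Proof.
by rewrite add_lfunE !comp_lfunE dsum_fstr dsum_sndr !linear0 add0r.
Qed.

Lemma dsum_counit_inl x : dsum_counit (dsum_inl x) = counit x.
Proof.
by rewrite add_lfunE !comp_lfunE dsum_fstl dsum_sndl linear0 addr0.
Qed.

Lemma dsum_counit_inr y : dsum_counit (dsum_inr y) = counit y.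
Proof.
by rewrite add_lfunE !comp_lfunE dsum_fstr dsum_sndr linear0 add0r.
Qed.

Lemma dsum_ext (V : vectType K) (f g : 'Hom(CD, V)) :
  (forall x, f (dsum_inl x) = g (dsum_inl x)) ->
  (forall y, f (dsum_inr y) = g (dsum_inr y)) -> f = g.
Proof.
move=> fgl fgr; apply/lfunP=> -[x y].
have -> : (x, y) = dsum_inl x + dsum_inr y.
  by rewrite !lfunE; congr pair; rewrite /= ?addr0 ?add0r.
by rewrite !linearD /= fgl fgr.
Qed.

Fact dsum_comulA (z : CD) :
  tassoc _ _ _ (tmap dsum_comul \1 (dsum_comul z)) =
  tmap \1 dsum_comul (dsum_comul z).
Proof.
rewrite -[LHS]comp_lfunE -[LHS]comp_lfunE -[RHS]comp_lfunE.
move: z; apply/lfunP; apply: dsum_ext => x; rewrite !comp_lfunE.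
  exact: comulA_push dsum_comull.
exact: comulA_push dsum_comulr.
Qed.

Fact dsum_counitl (z : CD) :
  tlift (fun a b : CD => (dsum_counit a : K) *: b) (dsum_comul z) = z.
Proof.
rewrite -[LHS]comp_lfunE -[RHS]id_lfunE.
move: z; apply/lfunP; apply: dsum_ext => x; rewrite comp_lfunE id_lfunE.
  exact: counitl_push dsum_comull dsum_counit_inl.
exact: counitl_push dsum_comulr dsum_counit_inr.
Qed.

Fact dsum_counitr (z : CD) :
  tlift (fun a b : CD => (dsum_counit b : K) *: a) (dsum_comul z) = z.
Proof.
rewrite -[LHS]comp_lfunE -[RHS]id_lfunE.
move: z; apply/lfunP; apply: dsum_ext => x; rewrite comp_lfunE id_lfunE.
  exact: counitr_push dsum_comull dsum_counit_inl.
exact: counitr_push dsum_comulr dsum_counit_inr.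
Qed.

HB.instance Definition _ := Vector_isCoalgebra.Build K CD
  dsum_comulA dsum_counitl dsum_counitr.

End DirectSum.

Definition is_subcoalg (K : fieldType) (C : coalgType K) (D : {vspace C}) :=
  (comul @: D <= tensv D D)%VS.

Definition subcoalg (K : fieldType) (C : coalgType K) (D : {vspace C})
  (hD : is_subcoalg D) : Type := subvs_of D.

HB.instance Definition _ (K : fieldType) (C : coalgType K) (D : {vspace C})
    (hD : is_subcoalg D) := Vector.on (subcoalg hD).

Section Subcoalgebra.
Variables (K : fieldType) (C : coalgType K) (D : {vspace C}).
Variable hD : is_subcoalg D.
Local Notation sD := (subcoalg hD).

Definition subcoalg_incl : 'Hom(sD, C) := linfun (vsval : subvs_of D -> C).
Definition subcoalg_proj : 'Hom(C, sD) := linfun (vsproj D).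

Definition subcoalg_comul : 'Hom(sD, tens sD sD) :=
  (tmap subcoalg_proj subcoalg_proj \o comul \o subcoalg_incl)%VF.

Definition subcoalg_counit : 'Hom(sD, K^o) := (counit \o subcoalg_incl)%VF.

Lemma subcoalg_inclE (x : sD) : subcoalg_incl x = vsval (x : subvs_of D).
Proof. by rewrite lfunE. Qed.

Lemma subcoalg_inclK x : subcoalg_proj (subcoalg_incl x) = x.
Proof. by rewrite !lfunE /= vsvalK. Qed.

Lemma subcoalg_projK x : x \in D -> subcoalg_incl (subcoalg_proj x) = x.
Proof. by move=> xD; rewrite !lfunE /= vsprojK. Qed.

Lemma subcoalg_incl_mem x : subcoalg_incl x \in D.
Proof. by rewrite subcoalg_inclE subvsP. Qed.

Lemma subcoalg_incl_inj : injective subcoalg_incl.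
Proof. exact: can_inj subcoalg_inclK. Qed.

Lemma subcoalg_comul_incl x :
  tmap subcoalg_incl subcoalg_incl (subcoalg_comul x) = comul (subcoalg_incl x).
Proof.
rewrite !comp_lfunE tmap_comp -comp_lfunE.
have: comul (subcoalg_incl x) \in tensv D D.
  by apply: (subvP hD); rewrite memv_img ?subcoalg_incl_mem.
set p := (subcoalg_incl \o subcoalg_proj)%VF.
suff /subvP sub : (tensv D D <= lker (tmap p p - \1%VF)%R)%VS.
  move=> /sub; rewrite memv_ker add_lfunE opp_lfunE id_lfunE subr_eq0 => /eqP.
  by rewrite comp_lfunE.
apply: tensvP => u v uD vD.
rewrite memv_ker add_lfunE opp_lfunE id_lfunE tmapE !comp_lfunE.
by rewrite !subcoalg_projK // subrr.
Qed.

Fact subcoalg_comulA (x : sD) :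
  tassoc _ _ _ (tmap subcoalg_comul \1 (subcoalg_comul x)) =
  tmap \1 subcoalg_comul (subcoalg_comul x).
Proof.
pose i := subcoalg_incl; pose p := subcoalg_proj.
have ip : (p \o i)%VF = \1%VF.
  by apply/lfunP => u; rewrite comp_lfunE id_lfunE subcoalg_inclK.
have inj3 : injective (tmap i (tmap i i)).
  apply: (can_inj (g := tmap p (tmap p p))) => t; rewrite tmap_comp ip.
  suff -> : (tmap p p \o tmap i i)%VF = \1%VF by rewrite tmap1.
  by apply/lfunP => s; rewrite comp_lfunE tmap_comp ip tmap1 id_lfunE.
have dE : (tmap i i \o subcoalg_comul = comul \o i)%VF.
  by apply/lfunP => u; rewrite comp_lfunE subcoalg_comul_incl comp_lfunE.
apply: inj3; rewrite -tassoc_tmap !tmap_comp dE.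
have l t : tmap (comul \o i) i t = tmap comul \1 (tmap i i t).
  by rewrite tmap_comp comp_lfun1l.
have r t : tmap i (comul \o i) t = tmap \1 comul (tmap i i t).
  by rewrite tmap_comp comp_lfun1l.
by rewrite comp_lfun1r l r subcoalg_comul_incl comulA.
Qed.

Fact subcoalg_counitl (x : sD) :
  tlift (fun a b : sD => (subcoalg_counit a : K) *: b) (subcoalg_comul x) = x.
Proof.
apply: subcoalg_incl_inj.
by rewrite -counitl_tmap subcoalg_comul_incl counitl.
Qed.

Fact subcoalg_counitr (x : sD) :
  tlift (fun a b : sD => (subcoalg_counit b : K) *: a) (subcoalg_comul x) = x.
Proof.
apply: subcoalg_incl_inj.
by rewrite -counitr_tmap subcoalg_comul_incl counitr.
Qed.

HB.instance Definition _ := Vector_isCoalgebra.Build K sD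
  subcoalg_comulA subcoalg_counitl subcoalg_counitr.

End Subcoalgebra.

Definition is_simple_subcoalg (K : fieldType) (C : coalgType K)
    (D : {vspace C}) : Prop :=
  [/\ is_subcoalg D, D != 0%VS &
      forall E : {vspace C}, is_subcoalg E -> (E <= D)%VS -> E = 0%VS \/ E = D].

Section SumFamily.
Variables (K : fieldType) (V : vectType K) (P : {vspace V} -> Prop).

Definition is_sumv (S : {vspace V}) : Prop :=
  (forall U, P U -> (U <= S)%VS) /\
  (forall W : {vspace V}, (forall U, P U -> (U <= W)%VS) -> (S <= W)%VS).

(* The sum of an arbitrary family of subspaces: by [sumv_ofP] the default 0 is
   never used. *)
Definition sumv_of : {vspace V} := xget 0%VS [set S | is_sumv S]%classic.

Lemma sumv_of_fin :
  exists2 s : seq {vspace V}, (forall U, U \in s -> P U) &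
    is_sumv (\sum_(U <- s) U)%VS.
Proof.
pose Q m := `[< exists2 s : seq {vspace V}, (forall U, U \in s -> P U) &
    \dim (\sum_(U <- s) U)%VS = m >].
have Q0 : exists m, Q m.
  by exists 0%N; apply/asboolP; exists [::]; rewrite // big_nil dimv0.
have Qmax m : Q m -> (m <= \dim {:V})%N.
  by case/asboolP=> s _ <-; apply: dimvS; apply: subvf.
case: (ex_maxnP Q0 Qmax) => m /asboolP[s sP sm] mmax; exists s => //.
split=> [U PU | W WP]; last first.
  rewrite big_seq; apply: (big_ind (fun X => (X <= W)%VS)) => [|X Y XW YW|U].
  - exact: sub0v.
  - by rewrite subv_add XW.
  - by move=> /sP /WP.
have : Q (\dim (\sum_(U <- U :: s) U)%VS).
  by apply/asboolP; exists (U :: s) => // W; rewrite inE => /predU1P[->|/sP].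
move=> /mmax; rewrite -sm big_cons => le.
have /eqP -> : (\sum_(U <- s) U == U + \sum_(U <- s) U)%VS.
  by rewrite eqEdim addvSr.
exact: addvSl.
Qed.

Lemma sumv_ofP : is_sumv sumv_of.
Proof.
have [s _ sS] := sumv_of_fin.
by apply: xgetPex; exists (\sum_(U <- s) U)%VS.
Qed.

Lemma sumv_of_seq :
  exists2 s : seq {vspace V}, (forall U, U \in s -> P U) &
    sumv_of = (\sum_(U <- s) U)%VS.
Proof.
have [s sP [s1 s2]] := sumv_of_fin; exists s => //.
have [t1 t2] := sumv_ofP; apply/eqP.
by rewrite eqEsubv t2 //= s2.
Qed.

End SumFamily.

Definition coradical (K : fieldType) (C : coalgType K) : {vspace C} :=
  sumv_of (@is_simple_subcoalg K C).
Arguments coradical {K} C.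

Lemma is_subcoalgD (K : fieldType) (C : coalgType K) (D E : {vspace C}) :
  is_subcoalg D -> is_subcoalg E -> is_subcoalg (D + E)%VS.
Proof.
move=> sD sE; rewrite /is_subcoalg limgD subv_add.
rewrite (subv_trans sD) ?(subv_trans sE) //; apply: tensvS;
  by [apply: addvSl | apply: addvSr].
Qed.

Lemma coradical_subcoalg (K : fieldType) (C : coalgType K) :
  is_subcoalg (coradical C).
Proof.
rewrite /coradical; have [s sP ->] := sumv_of_seq (@is_simple_subcoalg K C).
elim: s sP => [|D s IHs] sP.
  by rewrite /is_subcoalg big_nil limg0 sub0v.
rewrite big_cons; apply: is_subcoalgD.
  by have [] := sP D (mem_head _ _).
by apply: IHs => E Es; apply: sP; rewrite inE Es orbT.
Qed.

Definition coradical_coalg (K : fieldType) (C : coalgType K) : coalgType K :=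
  subcoalg (coradical_subcoalg C).

Definition cosemisimple (K : fieldType) (C : coalgType K) : bool :=
  coradical C == fullv.

Fixpoint corad_filt (K : fieldType) (C : coalgType K) (n : nat) : {vspace C} :=
  if n is n'.+1 then
    (comul @^-1: (tensv fullv (corad_filt C n') + tensv (coradical C) fullv))%VS
  else coradical C.

Section Grouplike.
Variables (K : fieldType) (C : coalgType K).

Definition is_grouplike (g : C) : bool :=
  (comul g == g ⊗ g) && ((counit g : K) == 1).

Lemma grouplike_free (s : seq C) :
  uniq s -> all is_grouplike s -> free s.
Proof.
elim: s => [|g s IHs] /=; first by rewrite nil_free.
case/andP=> gs us /andP[/andP[/eqP dg /eqP eg] sG].
have fs := IHs us sG; rewrite free_cons fs andbT; apply/negP => gspan.
have Ds i : (i < size s)%N -> comul s`_i = s`_i ⊗ s`_i.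
  by move=> lt; have /andP[/eqP] := allP sG _ (mem_nth 0 lt).
have gE := @coord_span _ _ _ (in_tuple s) g gspan.
pose c i : 'Hom(C, K^o) := linfun (coord (in_tuple s) i : C -> K^o).
have cE i : (c i g : K) *: g = (c i g : K) *: s`_i.
  pose L := tlift (fun a b : C => (c i a : K) *: b).
  have LE x y : L (x ⊗ y) = (c i x : K) *: y.
    by rewrite tlift_tensor //; apply: counitl_bilin.
  rewrite -LE -dg {1}gE !linear_sum (bigD1 i) //= !linearZ /= Ds // LE.
  rewrite lfunE /= coord_free // eqxx scale1r big1 ?addr0 => [|j ji].
    by rewrite lfunE.
  by rewrite !linearZ /= Ds // LE lfunE /= coord_free // (negPf ji) scale0r scaler0.
have [i ci] : exists i, (c i g : K) != 0.
  apply/existsP; apply: contraT => /existsPn c0.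
  have g0 : g = 0.
    rewrite gE big1 // => i _; have := c0 i; rewrite negbK lfunE /= => /eqP->.
    by rewrite scale0r.
  by move: eg; rewrite g0 linear0 => /eqP; rewrite eq_sym oner_eq0.
have gi : g = s`_i by apply: (scalerI ci); apply: cE.
by rewrite gi mem_nth in gs.
Qed.

Lemma grouplike_finite : finite_set [set g : C | is_grouplike g]%classic.
Proof.
apply: contrapT => inf.
have [X XG cX] := infinite_set_fset (\dim {:C}).+1 inf.
have fX : free X.
  by apply: grouplike_free; [exact: fset_uniq | apply/allP => g /XG].
have := dimvS (subvf <<X>>%VS); rewrite (eqP fX) leqNgt => /negP; apply.
exact: cX.
Qed.

(* Finite by [grouplike_finite], so no element is lost: see [mem_grouplikes]. *)
Definition grouplikes : {fset C} :=
  fset_set [set g : C | is_grouplike g]%classic.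

Lemma mem_grouplikes g : (g \in grouplikes) = is_grouplike g.
Proof.
by rewrite in_fset_set; [apply/idP/idP; rewrite in_setE|exact: grouplike_finite].
Qed.

Definition is_skew_primitive (x : C) : Prop :=
  exists g h, [/\ g \in grouplikes, h \in grouplikes &
                  comul x = g ⊗ x + x ⊗ h].

(* k[G(C)] is the span of G(C). *)
Definition is_nontrivial_skew_primitive (x : C) : Prop :=
  is_skew_primitive x /\ x \notin <<grouplikes>>%VS.

End Grouplike.

Section P1.
Variables (K : fieldType) (C : coalgType K).
Local Notation C0 := (coradical_coalg C).

Definition coradical_incl : 'Hom(C0, C) :=
  subcoalg_incl (coradical_subcoalg C).

Definition is_coradical_proj (p : 'Hom(C, C0)) : Prop :=
  coalg_hom p /\ (forall x : C0, p (coradical_incl x) = x).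

Variable p : 'Hom(C, C0).

Definition rhoL : 'Hom(C, tens C0 C) := (tmap p \1 \o comul)%VF.
Definition rhoR : 'Hom(C, tens C C0) := (tmap \1 p \o comul)%VF.

(* The x with comul x = rhoL x + rhoR x, see [memP1], where C_0 ⊗ C and C ⊗ C_0
   are viewed in C ⊗ C through the inclusion of C_0. *)
Definition P1 : {vspace C} :=
  lker (comul - ((tmap coradical_incl \1 \o rhoL)
                 + (tmap \1 coradical_incl \o rhoR)))%VF.

Lemma memP1 x :
  x \in P1 <-> comul x = tmap coradical_incl \1 (rhoL x)
                          + tmap \1 coradical_incl (rhoR x).
Proof.
rewrite memv_ker add_lfunE opp_lfunE add_lfunE subr_eq0.
rewrite /rhoL /rhoR !comp_lfunE.
by split=> [/eqP|xP]; last apply/eqP.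
Qed.

Hypothesis p_proj : is_coradical_proj p.

Lemma P1_preim :
  P1 = (comul @^-1: (tensv (coradical C) (lker p)
                     + tensv (lker p) (coradical C)))%VS.
Proof.
pose q : 'End(C) := (coradical_incl \o p)%VF.
have qid x : x \in coradical C -> q x = x.
  move=> xC; rewrite comp_lfunE.
  have xE : coradical_incl (subcoalg_proj (coradical_subcoalg C) x) = x.
    exact: subcoalg_projK.
  by rewrite -{1}xE (proj2 p_proj) xE.
have qC x : q x \in coradical C by rewrite comp_lfunE subcoalg_incl_mem.
have qq x : q (q x) = q x by rewrite qid.
have qker x : x - q x \in lker p.
  by rewrite memv_ker linearB /= comp_lfunE (proj2 p_proj) subrr.
have memq x : (x \in P1) <-> comul x = tmap q \1 (comul x) + tmap \1 q (comul x).
  by rewrite memP1 /rhoL /rhoR !comp_lfunE !tmap_comp comp_lfun1l.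
apply/vspaceP => x; rewrite -memv_preim; apply/idP/idP => [/memq|xD].
  move: (comul x) => t tE.
  have qqt : tmap q q t = 0.
    have := congr1 (tmap q \1) tE; rewrite linearD /= !tmap_comp.
    rewrite comp_lfun1l comp_lfun1r comp_lfun1l.
    have -> : (q \o q = q)%VF by apply/lfunP => y; rewrite comp_lfunE qq.
    by move/eqP; rewrite -subr_eq0 opprD addrA subrr sub0r oppr_eq0 => /eqP.
  have -> : t = tmap q (\1 - q)%VF t + tmap (\1 - q)%VF q t.
    have l : tmap q (\1 - q)%VF = (tmap q \1 - tmap q q)%VF.
      apply: tens_ext => y z; rewrite add_lfunE opp_lfunE !tmapE.
      by rewrite add_lfunE opp_lfunE tensorDr -scaleN1r tensorZr scaleN1r.
    have r : tmap (\1 - q)%VF q = (tmap \1 q - tmap q q)%VF.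
      apply: tens_ext => y z; rewrite add_lfunE opp_lfunE !tmapE.
      by rewrite add_lfunE opp_lfunE tensorDl -scaleN1r tensorZl scaleN1r.
    by rewrite l r !add_lfunE !opp_lfunE qqt !subr0.
  apply: memv_add; rewrite [t]tensor_basis !linear_sum /=;
    apply: rpred_sum => i _; rewrite linear_sum /=; apply: rpred_sum => j _;
    rewrite linearZ /= rpredZ // tmapE mem_tensv // add_lfunE opp_lfunE id_lfunE;
    exact: qker.
apply/memq; move: (comul x) xD => t.
suff /subvP sub : (tensv (coradical C) (lker p) + tensv (lker p) (coradical C)
                   <= lker (\1%VF - (tmap q \1 + tmap \1 q)%VF)%R)%VS.
  move=> /sub; rewrite memv_ker add_lfunE opp_lfunE add_lfunE id_lfunE.
  by rewrite subr_eq0 => /eqP.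
have qk y : y \in lker p -> q y = 0.
  by rewrite memv_ker comp_lfunE => /eqP->; rewrite linear0.
have tensor0l (y : C) : 0 ⊗ y = 0 :> tens C C.
  by rewrite -(scale0r 0) tensorZl scale0r.
have tensor0r (y : C) : y ⊗ 0 = 0 :> tens C C.
  by rewrite -(scale0r 0) tensorZr scale0r.
by rewrite subv_add; apply/andP; split; apply: tensvP => y z yV zV;
  rewrite memv_ker add_lfunE opp_lfunE add_lfunE !tmapE !id_lfunE;
  [rewrite (qid y) // (qk z) // tensor0r addr0 subrr
  |rewrite (qk y) // (qid z) // tensor0l add0r subrr].
Qed.

End P1.

(* The coalgebra k[T] ⊕ M^c(n_1, k) ⊕ ... ⊕ M^c(n_t, k) for
   ns = [:: n_1; ...; n_t]. *)
Definition grp_mx_coalg (K : fieldType) (T : finType) (ns : seq nat) :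
    coalgType K :=
  foldl (fun (C : coalgType K) n => dsum C (mxcoalg K n) : coalgType K)
        (grpcoalg K T : coalgType K) ns.

(* Main.v *)
(* Work in the convolution algebra A = H^*, whose radical J is the annihilator of
   H_0: J is contained in every maximal two-sided ideal of A, hence is nilpotent.
   The projection pi splits A as A_0 + J with A_0 a copy of (H_0)^*.

   For g grouplike let A_g be the ideal of the a with a(g) = 0.  If J = A_g J, a
   lift e to A of the coordinate functional of g on H_0 satisfies e^m A_g <= J^m,
   so a power of e is a normalised integral and H is cosemisimple by Maschke's
   theorem.  Hence some x outside H_0 is killed by A_g J, and x - pi(x) is a
   nonzero element of the component P_1^{g,*} of P_1.  Its H_0-coefficients avoid
   the grouplikes since there are no nontrivial skew primitives, so the matrix
   units of a block of size at least n_1 produce n_1 independent elements.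
   These components and their mirror images P_1^{*,g} are independent.

   If H = H_1, then J^2 = 0 and J e_1 contains a nonzero integral lambda of H.
   Integrals are unique up to scalars, so lambda is also an eigenvector for the
   other action of A, with a grouplike weight g; since lambda lies in J, it
   detects a nontrivial skew primitive element. *)

Require Import Defs.
From HB Require Import structures.
From mathcomp Require Import all_boot all_algebra falgebra.
From mathcomp Require Import finmap.
From mathcomp Require Import boolp classical_sets.

Set Implicit Arguments.
Unset Strict Implicit.
Unset Printing Implicit Defensive.

Import GRing.Theory.
Local Open Scope ring_scope.

(** * Subspaces cut out by linear predicates *)

Section SubspaceOfPredicate.
Variables (K : fieldType) (V : vectType K).
Implicit Type P : V -> Prop.

Definition submod_pred P : Prop :=
  P 0 /\ forall a x y, P x -> P y -> P (a *: x + y).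

(** Taken as the sum of the subspaces on which [P] holds, so that it exists for every [P]; it is the
    set of solutions when [P] is closed under linear combinations. *)
Definition vspace_of P : {vspace V} :=
  sumv_of (fun U : {vspace V} => forall x, x \in U -> P x).

Lemma mem_vspace_of P x : submod_pred P -> (x \in vspace_of P) <-> P x.
Proof.
move=> [P0 Plin]; have [PS _] := sumv_ofP (fun U : {vspace V} => forall x, x \in U ->
  P x).
split=> [|Px]; last first.
  apply: (subvP (PS <[x]>%VS _)) (memv_line x) => _ /vlineP[k ->].
  by rewrite -[k *: x]addr0; apply: Plin.
rewrite /vspace_of.
have [s sP ->] := sumv_of_seq (fun U : {vspace V} => forall x, x \in U -> P x).
elim: s sP x => [|U s IHs] sP x.
  by rewrite big_nil memv0 => /eqP->.
rewrite big_cons => /memv_addP[u uU [v vs ->]].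
rewrite -[u]scale1r; apply: Plin; first by apply: (sP U); rewrite ?mem_head.
by apply: IHs vs => W Ws; apply: sP; rewrite inE Ws orbT.
Qed.

End SubspaceOfPredicate.

(** * Nilpotency of the radical *)

Section Nilpotency.
Variables (K : fieldType) (A : falgType K).
Implicit Types (I J L M N U : {vspace A}) (a b x y : A).

Definition is_ideal I : Prop := forall a x b, x \in I -> a * x * b \in I.

Definition is_lideal I : Prop := forall a x, x \in I -> a * x \in I.

Definition is_max_ideal M : Prop :=
  [/\ is_ideal M, 1 \notin M &
      forall I, is_ideal I -> (M <= I)%VS -> 1 \notin I -> I = M].

Lemma ideal_lideal I : is_ideal I -> is_lideal I.
Proof. by move=> idI a x /(idI a x 1); rewrite mulr1. Qed.

(* N / N' is a simple left module not annihilated by the ideal I: then I acts on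
   it as a unital ring. *)
Lemma simple_quotient_unit I N N' :
    is_ideal I -> is_lideal N -> is_lideal N' -> (N' <= N)%VS ->
    (forall U, is_lideal U -> (N' <= U)%VS -> (U <= N)%VS -> U = N' \/ U = N) ->
    ~ (forall a x, a \in I -> x \in N -> a * x \in N') ->
  exists2 u, u \in I & forall x, x \in N -> x - u * x \in N'.
Proof.
move=> idI lN lN' sN'N simp nIN.
(* [Q] cuts out a left submodule between [N'] and [N]. By simplicity it is one of the two, and [N]
   is excluded because [I] acts nontrivially. *)
pose Q x := x \in N /\ (forall a, a \in I -> a * x \in N').
have Qsub : submod_pred Q.
  split; first by split=> [|a aI]; rewrite ?mulr0 mem0v.
  move=> k x y [xN xI] [yN yI]; split; first by rewrite memvD ?memvZ.
  by move=> a aI; rewrite mulrDr -scalerAr memvD ?memvZ ?xI ?yI.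
have Q_N' x : Q x -> x \in N'.
  move=> Qx; suff <- : vspace_of Q = N' by apply/mem_vspace_of.
  have [|||//|QN] := simp (vspace_of Q).
  - move=> a z /mem_vspace_of-/(_ Qsub)[zN zI]; apply/mem_vspace_of => //.
    split=> [|b bI]; first exact: lN.
    by rewrite mulrA; apply: zI; have := idI 1 b a bI; rewrite mul1r.
  - apply/subvP=> z zN'; apply/mem_vspace_of => //; split.
      exact: (subvP sN'N).
    by move=> a _; apply: lN'.
  - by apply/subvP=> z /mem_vspace_of-/(_ Qsub)[].
  case: nIN => a z aI zN.
  have : z \in vspace_of Q by rewrite QN.
  by move/mem_vspace_of => /(_ Qsub)[_]; apply.
(* Density argument: it is enough that [u] fixes a basis of [N] modulo [N'], and [u] is built one
   vector at a time. *)
suff vsP (vs : seq A) : (forall x, x \in vs -> x \in N) ->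
    exists2 u, u \in I & forall x, x \in vs -> x - u * x \in N'.
  have [x xN|u uI uP] := vsP (vbasis N); first exact: vbasis_mem.
  exists u => // x xN; rewrite (coord_vbasis xN) mulr_sumr -sumrB.
  apply: memv_suml => i _; rewrite -scalerAr -scalerBr memvZ // uP //.
  by rewrite mem_nth ?size_tuple.
elim: vs => [|v vs IHvs] vsN; first by exists 0; rewrite ?mem0v.
have vN : v \in N by apply: vsN; rewrite mem_head.
have [x xs|u0 u0I u0P] := IHvs; first by apply: vsN; rewrite inE xs orbT.
(* Elements satisfying [P] can be added to [u0] without spoiling the earlier vectors. If they carry
   [v] onto [N] modulo [N'], one of them repairs [u0] at [v]. Otherwise they kill [v] modulo [N'];
   each [a - a * u0] with [a] in [I] is one of them, so [v - u0 * v] satisfies [Q]. *)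
pose P c := c \in I /\ forall x, x \in vs -> c * x \in N'.
have Psub : submod_pred P.
  split; first by split=> [|x _]; rewrite ?mul0r mem0v.
  move=> k c d [cI cP] [dI dP]; split; first by rewrite memvD ?memvZ.
  by move=> x xs; rewrite mulrDl -scalerAl memvD ?memvZ ?cP ?dP.
pose U := (N' + amulr v @: vspace_of P)%VS.
have lU : is_lideal U.
  move=> a z /memv_addP[z1 z1N' [z2 /memv_imgP[c /mem_vspace_of-/(_ Psub)[cI cP] ->]
    ->]].
  rewrite mulrDr memv_add ?lN' // lfunE /= mulrA.
  rewrite -[a * c * v]/((v \o* idfun) (a * c)) -[_ (a * c)]lfunE memv_img //.
  apply/mem_vspace_of => //; split; first exact: ideal_lideal.
  by move=> x xs; rewrite -mulrA lN' ?cP.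
have sUN : (U <= N)%VS.
  rewrite subv_add sN'N; apply/subvP=> _ /memv_imgP[c _ ->].
  by rewrite lfunE; apply: lN.
have vuN : v - u0 * v \in N by rewrite memvB ?lN.
have [UN'|UN] := simp U lU (addvSl _ _) sUN; last first.
  have : v - u0 * v \in U by rewrite UN.
  case/memv_addP=> z1 z1N' [_ /memv_imgP[c /mem_vspace_of-/(_ Psub)[cI cP] ->]].
  rewrite lfunE /= => vE; exists (u0 + c); first exact: memvD.
  move=> x; rewrite inE => /predU1P[->|xs].
    by rewrite mulrDl opprD addrA vE addrK.
  by rewrite mulrDl opprD addrA memvB ?u0P ?cP.
exists u0 => // x; rewrite inE => /predU1P[->|xs]; last exact: u0P.
apply: Q_N'; split=> // a aI.
have -> : a * (v - u0 * v) = (a - a * u0) * v by rewrite mulrBr mulrBl mulrA.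
rewrite -UN' -[_ * v]/((v \o* idfun) (a - a * u0)) -[_ (a - _)]lfunE.
apply: (subvP (addvSr _ _)); apply: memv_img; apply/mem_vspace_of => //.
split; first by rewrite memvB //; have := idI 1 a u0 aI; rewrite mul1r.
by move=> y ys; rewrite mulrBl -mulrA -mulrBr lN' ?u0P.
Qed.

(** The last clause says that [N / N'] is a simple left module; a proper left ideal of largest
    dimension inside [N] has this property. *)
Lemma exists_max_lideal N : is_lideal N -> N != 0%VS ->
  exists N', [/\ is_lideal N', (N' <= N)%VS, N' != N &
    forall U, is_lideal U -> (N' <= U)%VS -> (U <= N)%VS -> U = N' \/ U = N].
Proof.
move=> lN N0.
pose Q m := `[< exists U, [/\ is_lideal U, (U <= N)%VS, U != N & \dim U = m] >].
have Q0 : exists m, Q m.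
  exists 0%N; apply/asboolP; exists 0%VS; split; rewrite ?dimv0 ?sub0v 1?eq_sym //.
  by move=> a x; rewrite !memv0 => /eqP->; rewrite mulr0.
have Qmax m : Q m -> (m <= \dim N)%N by case/asboolP=> U [_ UN _ <-]; apply: dimvS.
case: (ex_maxnP Q0 Qmax) => m /asboolP[N' [lN' sN' nN' dN']] mmax; exists N'.
split=> // U lU sN'U sUN; have [->|nUN] := eqVneq U N; [by right | left].
apply/esym/eqP; rewrite eqEdim sN'U dN'; apply: mmax; apply/asboolP.
by exists U.
Qed.

(** [M] is the annihilator of the simple module [N / N']. A two-sided ideal strictly above [M] does
    not annihilate the module, hence contains some [u] acting as the identity; then [1 - u] lies in
    [M], and the ideal contains [1]. *)
Lemma annihilator_max N N' : is_lideal N -> is_lideal N' -> (N' <= N)%VS -> N' != N ->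
    (forall U, is_lideal U -> (N' <= U)%VS -> (U <= N)%VS -> U = N' \/ U = N) ->
  exists2 M, is_max_ideal M & forall a, a \in M -> forall x, x \in N -> a * x \in N'.
Proof.
move=> lN lN' sN' nN' simp.
pose P a := forall x, x \in N -> a * x \in N'.
have Psub : submod_pred P.
  split=> [x _|k a b aP bP x xN]; first by rewrite mul0r mem0v.
  by rewrite mulrDl -scalerAl memvD ?memvZ ?aP ?bP.
have memP a := mem_vspace_of a Psub.
have idM : is_ideal (vspace_of P).
  move=> a x b /memP xP; apply/memP => y yN.
  by rewrite -!mulrA lN' // xP // lN.
exists (vspace_of P) => [|a /memP //]; split=> //.
  apply/negP => /memP P1; case/negP: nN'; rewrite eqEsubv sN' /=.
  by apply/subvP=> x /P1; rewrite mul1r.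
move=> I idI sMI I1; apply/esym/eqP; rewrite eqEsubv sMI /=.
have [allI|/existsNP[a /existsNP[x /not_implyP[aI /not_implyP[xN axN']]]]] :=
  pselect (forall a x, a \in I -> x \in N -> a * x \in N').
  by apply/subvP => a aI; apply/memP => x; apply: allI.
have [|u uI uP] := simple_quotient_unit idI lN lN' sN' simp;
  first by move/(_ a x aI xN).
case/negP: I1; rewrite -(subrK u 1) memvD // (subvP sMI) //; apply/memP => y yN.
by rewrite mulrBl mul1r uP.
Qed.

Lemma ideal_exp J m : is_ideal J -> is_lideal (J ^+ m.+1)%VS.
Proof.
move=> idJ a x; rewrite expvSl => xJ.
suff /subvP/(_ x xJ) : (J * J ^+ m <= amull a @^-1: (J * J ^+ m))%VS.
  by rewrite -memv_preim lfunE.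
apply/prodvP=> u v uJ vJ; rewrite -memv_preim lfunE /= mulrA memv_mul //.
exact: ideal_lideal.
Qed.

(** If the powers of [J] became stationary at a nonzero N, then N would have a simple quotient
    [N / N'] whose annihilator is a maximal two-sided ideal, hence contains [J]. So J N would lie in
    the proper part [N'], although J N = N. *)
Lemma nilpotent_radical J : is_ideal J ->
  (forall M, is_max_ideal M -> (J <= M)%VS) -> exists m, (J ^+ m)%VS = 0%VS.
Proof.
move=> idJ radJ.
have sJ m : (J ^+ m.+2 <= J ^+ m.+1)%VS.
  rewrite expvSl; apply/prodvP => a x _; exact: ideal_exp.
have [m /eqP Jm] : exists m, (J ^+ m.+2 == J ^+ m.+1)%VS.
  apply: contrapT => /forallNP nJ.
  have dlt m : (\dim (J ^+ m.+2) < \dim (J ^+ m.+1))%N.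
    have := nJ m; rewrite eqEdim sJ /= => /negP; by rewrite -ltnNge.
  have dle m : (\dim (J ^+ m.+1) + m <= \dim {:A})%N.
    elim: m => [|m IHm]; first by rewrite addn0 dimvS ?subvf.
    by rewrite addnS (leq_trans _ IHm) // -addSn leq_add2r.
  by have := dle (\dim {:A}).+1; rewrite addnS ltnNge leq_addl.
exists m.+1; apply/eqP; apply: contraT => N0.
have lN := @ideal_exp J m idJ.
have [N' [lN' sN' nN' simp]] := exists_max_lideal lN N0.
have [M maxM MP] := annihilator_max lN lN' sN' nN' simp.
case/negP: nN'; rewrite eqEsubv sN' -Jm expvSl; apply/prodvP => a x aJ xN.
by apply: MP => //; apply: (subvP (radJ M maxM)).
Qed.

End Nilpotency.

(** * The convolution algebra of the dual *)

Section TensorFunctional.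
Variable K : fieldType.
Implicit Types U V W : vectType K.

Definition functional_tensor U V (a : 'Hom(U, K^o)) (b : 'Hom(V, K^o)) :
    'Hom(tens U V, K^o) :=
  tlift (fun x y => (a x : K) *: b y).

Lemma functional_tensorE U V (a : 'Hom(U, K^o)) (b : 'Hom(V, K^o)) x y :
  functional_tensor a b (x ⊗ y) = (a x : K) *: b y.
Proof.
rewrite tlift_tensor //; split=> z k u v; rewrite linearP /=.
  by rewrite scalerDl scalerA.
by rewrite scalerDr !scalerA mulrC.
Qed.

Lemma functional_tensor_tmap U V U' V' (f : 'Hom(U, U')) (g : 'Hom(V, V')) a b t :
  functional_tensor a b (tmap f g t) = functional_tensor (a \o f) (b \o g) t.
Proof.
rewrite -[LHS]comp_lfunE; move: t; apply/lfunP/tens_ext => x y.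
by rewrite comp_lfunE tmapE !functional_tensorE !comp_lfunE.
Qed.

Lemma functional_tensorA U V W (a : 'Hom(U, K^o)) (b : 'Hom(V, K^o))
    (c : 'Hom(W, K^o)) t :
  functional_tensor a (functional_tensor b c) (tassoc U V W t) =
  functional_tensor (functional_tensor a b) c t.
Proof.
rewrite -[LHS]comp_lfunE; move: t; apply/lfunP/tens_ext3 => x y z.
by rewrite comp_lfunE tassocE !functional_tensorE scalerA.
Qed.

Lemma functional_tensor_sep U V (s t : tens U V) :
  (forall a b, functional_tensor a b s = functional_tensor a b t) -> s = t.
Proof.
move=> st; apply/matrixP => i j.
pose a : 'Hom(U, K^o) := linfun (coord (vbasis fullv) i : U -> K^o).
pose b : 'Hom(V, K^o) := linfun (coord (vbasis fullv) j : V -> K^o).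
have abE r : functional_tensor a b r = r i j.
  have fU := basis_free (vbasisP {:U}); have fV := basis_free (vbasisP {:V}).
  rewrite [r in LHS]tensor_basis linear_sum (bigD1 i) //= linear_sum (bigD1 j) //=.
  rewrite linearZ /= functional_tensorE !lfunE /= !coord_free // !eqxx.
  rewrite big1 ?addr0 => [|l lj]; last first.
    rewrite linearZ /= functional_tensorE !lfunE /= !coord_free // (negPf lj).
    by rewrite !scaler0.
  rewrite big1 ?addr0 => [|k ki]; last first.
    rewrite linear_sum big1 // => l _.
    rewrite linearZ /= functional_tensorE !lfunE /= !coord_free // (negPf ki).
    by rewrite scale0r scaler0.
  by rewrite scale1r; apply: mulr1.
by rewrite -!abE.
Qed.

Lemma functional_sep V (x y : V) :
  (forall a : 'Hom(V, K^o), a x = a y) -> x = y.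
Proof.
move=> axy; rewrite (coord_vbasis (memvf x)) (coord_vbasis (memvf y)).
apply: eq_bigr => i _.
by have := axy (linfun (coord (vbasis fullv) i : V -> K^o)); rewrite !lfunE /= => ->.
Qed.

(** If every functional that kills [D] killed [x], then composing arbitrary functionals with
    [\1 - projv D] would show that [x] equals its projection to [D]. *)
Lemma functional_separates V (D : {vspace V}) x : x \notin D ->
  exists2 a : 'Hom(V, K^o), a x <> 0 & forall y, y \in D -> a y = 0.
Proof.
move=> xD; apply: contrapT => /forallPNP na; case/negP: xD.
have : x - projv D x = 0.
  apply: functional_sep => a; rewrite linear0.
  have nb := na (a \o (\1 - projv D))%VF.
  apply: contrapT => ax; apply: nb; first by rewrite !lfun_simp.
  by move=> y yD; rewrite !lfun_simp projv_id // subrr linear0.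
by move/subr0_eq => ->; apply: memv_proj.
Qed.

End TensorFunctional.

Section Convolution.
Variables (K : fieldType) (C : coalgType K).
Implicit Types a b c : 'Hom(C, K^o).

Definition convolution a b : 'Hom(C, K^o) := (functional_tensor a b \o comul)%VF.

Lemma convolutionE a b x : convolution a b x = functional_tensor a b (comul x).
Proof. by rewrite comp_lfunE. Qed.

Lemma convolutionA : associative convolution.
Proof.
move=> a b c; apply/lfunP => x; rewrite !convolutionE.
have -> : functional_tensor a (convolution b c) (comul x) =
    functional_tensor a (functional_tensor b c) (tmap \1 comul (comul x)).
  by rewrite functional_tensor_tmap comp_lfun1r.
by rewrite -comulA functional_tensorA functional_tensor_tmap comp_lfun1r.
Qed.

Lemma convolution1l : left_id counit convolution.
Proof.
move=> a; apply/lfunP => x; rewrite convolutionE -[in RHS](counitl x).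
rewrite -[RHS]comp_lfunE; move: (comul x); apply/lfunP/tens_ext => u v.
rewrite comp_lfunE functional_tensorE tlift_tensor ?linearZ //.
exact: counitl_bilin.
Qed.

Lemma convolution1r : right_id counit convolution.
Proof.
move=> a; apply/lfunP => x; rewrite convolutionE -[in RHS](counitr x).
rewrite -[RHS]comp_lfunE; move: (comul x); apply/lfunP/tens_ext => u v.
rewrite comp_lfunE functional_tensorE tlift_tensor.
  by rewrite linearZ; apply: mulrC.
exact: counitr_bilin.
Qed.

Lemma convolution_is_bilinear : bilin convolution.
Proof.
split=> c k a b; apply/lfunP => x; rewrite /= add_lfunE scale_lfunE !convolutionE;
  move: (comul x) => t; rewrite [t]tensor_basis !linear_sum -big_split /=;
  apply: eq_bigr => i _; rewrite !linear_sum -big_split /=;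
  apply: eq_bigr => j _; rewrite !linearZ /= !functional_tensorE !lfun_simp.
  by rewrite scalerDl scalerDr !scalerA; congr (_ *: _ + _); apply: mulrA.
rewrite !scalerDr !scalerA; congr (_ *: _ + _).
by rewrite -!mulrA [_ * k]mulrC.
Qed.

Lemma comul_tensorP x y z :
  (forall a b, convolution a b x = (a y : K) *: b z) -> comul x = y ⊗ z.
Proof.
move=> xyz; apply: functional_tensor_sep => a b.
by rewrite -convolutionE functional_tensorE.
Qed.

End Convolution.

Lemma convolution_comp (K : fieldType) (C D : coalgType K) (f : 'Hom(C, D))
    (a b : 'Hom(D, K^o)) :
  (forall x, comul (f x) = tmap f f (comul x)) ->
  convolution (a \o f)%VF (b \o f)%VF = (convolution a b \o f)%VF.
Proof.
move=> fM; apply/lfunP => x.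
by rewrite comp_lfunE !convolutionE fM functional_tensor_tmap.
Qed.

(** A separate name for the space of functionals, which carries the convolution product as its ring
    structure. *)
Definition dual (K : fieldType) (H : hopfType K) : Type := 'Hom(H, K^o).

HB.instance Definition _ (K : fieldType) (H : hopfType K) := Vector.on (dual H).

Section Dual.
Variables (K : fieldType) (H : hopfType K).

Definition dual_mul : dual H -> dual H -> dual H := @convolution K H.

Fact dual_mulDl : left_distributive dual_mul +%R.
Proof.
move=> a b c; have := (convolution_is_bilinear H).1 c 1 a b.
by rewrite !scale1r.
Qed.

Fact dual_mulDr : right_distributive dual_mul +%R.
Proof.
move=> c a b; have := (convolution_is_bilinear H).2 c 1 a b.
by rewrite !scale1r.
Qed.

Fact dual_1_neq0 : (counit : dual H) != 0.
Proof.
apply/eqP => /lfunP/(_ (1 : H)); rewrite counit1 zero_lfunE => /eqP.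
by rewrite oner_eq0.
Qed.

HB.instance Definition _ := GRing.Zmodule_isNzRing.Build (dual H)
  (@convolutionA K H) (@convolution1l K H) (@convolution1r K H)
  dual_mulDl dual_mulDr dual_1_neq0.

Fact dual_scalerAl (k : K) (a b : dual H) : k *: (a * b) = (k *: a) * b.
Proof.
have := (convolution_is_bilinear H).1 b k a 0; rewrite addr0 => E.
by apply: etrans (esym E); rewrite -[convolution 0 b]/((0 : dual H) * b) mul0r addr0.
Qed.

Fact dual_scalerAr (k : K) (a b : dual H) : k *: (a * b) = a * (k *: b).
Proof.
have := (convolution_is_bilinear H).2 a k b 0; rewrite addr0 => E.
by apply: etrans (esym E); rewrite -[convolution a 0]/(a * (0 : dual H)) mulr0 addr0.
Qed.

HB.instance Definition _ := GRing.Lmodule_isLalgebra.Build K (dual H) dual_scalerAl.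
HB.instance Definition _ := GRing.Lalgebra_isAlgebra.Build K (dual H) dual_scalerAr.
HB.instance Definition _ := Algebra_isFalgebra.Build K (dual H).

Definition ev (a : dual H) (x : H) : K := (a : 'Hom(H, K^o)) x.

Implicit Types (a b : dual H) (x y : H).

Lemma evDl a b x : ev (a + b) x = ev a x + ev b x.
Proof. exact: (@add_lfunE _ _ _ (a : 'Hom(H, K^o)) b x). Qed.
Lemma evZl k a x : ev (k *: a) x = k * ev a x.
Proof. exact: (@scale_lfunE _ _ _ k (a : 'Hom(H, K^o)) x). Qed.
Lemma ev0l x : ev 0 x = 0.
Proof. exact: (@zero_lfunE K H K^o x). Qed.
Lemma evNl a x : ev (- a) x = - ev a x.
Proof. exact: (@opp_lfunE _ _ _ (a : 'Hom(H, K^o)) x). Qed.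
Lemma evBl a b x : ev (a - b) x = ev a x - ev b x.
Proof. by rewrite evDl evNl. Qed.
Lemma ev_suml I (r : seq I) (P : pred I) (F : I -> dual H) x :
  ev (\sum_(i <- r | P i) F i) x = \sum_(i <- r | P i) ev (F i) x.
Proof. by apply: (big_morph (ev^~ x)) => [a b|]; rewrite ?evDl ?ev0l. Qed.

Lemma evDr a x y : ev a (x + y) = ev a x + ev a y.
Proof. by rewrite /ev linearD. Qed.
Lemma evZr k a x : ev a (k *: x) = k * ev a x.
Proof. by rewrite /ev linearZ. Qed.
Lemma ev0r a : ev a 0 = 0.
Proof. by rewrite /ev linear0. Qed.
Lemma evBr a x y : ev a (x - y) = ev a x - ev a y.
Proof. by rewrite /ev linearB. Qed.
Lemma ev_sumr a I (r : seq I) (P : pred I) (F : I -> H) :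
  ev a (\sum_(i <- r | P i) F i) = \sum_(i <- r | P i) ev a (F i).
Proof. by apply: (big_morph (ev a)) => [x y|]; rewrite ?evDr ?ev0r. Qed.

Lemma ev_inj a b : (forall x, ev a x = ev b x) -> a = b.
Proof. by move=> ab; apply/lfunP. Qed.

Lemma ev_sep x y : (forall a, ev a x = ev a y) -> x = y.
Proof. exact: functional_sep. Qed.

Lemma evM a b x : ev (a * b) x = functional_tensor a b (comul x).
Proof. exact: convolutionE. Qed.

Lemma ev1 x : ev 1 x = counit x. Proof. by []. Qed.

Lemma ev1_1 : ev 1 1 = 1. Proof. exact: counit1. Qed.

(** Grouplike elements are the algebra homomorphisms from [dual H] to [K]; below they are used and
    constructed in this form. *)
Lemma is_grouplikeP (g : H) :
  is_grouplike g <-> (forall a b, ev (a * b) g = ev a g * ev b g) /\ ev 1 g = 1.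
Proof.
split=> [/andP[/eqP dg /eqP eg]|[gM g1]].
  by split=> // a b; rewrite evM dg functional_tensorE.
apply/andP; split; last exact/eqP.
by apply/eqP/comul_tensorP => a b; apply: gM.
Qed.

(** Reflexivity of a finite dimensional space: the coordinates of the element are the values of [F]
    on the dual basis [d]. *)
Lemma ev_onto (F : dual H -> K) :
  (forall k a b, F (k *: a + b) = k * F a + F b) ->
  exists x, forall a, ev a x = F a.
Proof.
move=> Flin; pose d i : dual H := linfun (coord (vbasis {:H}) i : H -> K^o).
exists (\sum_(i < \dim {:H}) F (d i) *: (vbasis {:H})`_i) => a.
have F0 : F 0 = 0.
  by have := Flin 1 0 0; rewrite scaler0 addr0 mul1r => /(congr1 (fun z => z - F 0));
    rewrite addrK subrr.
have aE : a = \sum_(i < \dim {:H}) ev a (vbasis {:H})`_i *: d i.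
  apply: ev_inj => x; rewrite [in LHS](coord_vbasis (memvf x)) ev_sumr ev_suml.
  by apply: eq_bigr => i _; rewrite evZr evZl mulrC /d /ev lfunE.
rewrite ev_sumr [in RHS]aE (big_morph F (id1 := 0) (op1 := +%R)) => [|u v|//].
  by apply: eq_bigr => i _; rewrite evZr -[_ *: d i]addr0 Flin F0 addr0 mulrC.
by rewrite -[u in LHS]scale1r Flin mul1r.
Qed.

End Dual.

(** * Sweedler calculus and integrals *)

Section LinearFunctions.
Variables (K : fieldType).
Implicit Types U V W Z Y : vectType K.

Lemma linear_linfun U V (f : U -> V) : linear f -> linfun f =1 f.
Proof.
move=> lf x; pose L : {linear U -> V} :=
  HB.pack f (GRing.isLinear.Build K U V _ f lf).
exact: (lfunE L).
Qed.

Lemma lin_hom U V (g : 'Hom(U, V)) : linear g.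
Proof. by move=> k x y; rewrite linearP. Qed.

Lemma tlift_apply U V W Z (f : W -> Z) (B : U -> V -> W) t :
  linear f -> f (tlift B t) = tlift (fun u v => f (B u v)) t.
Proof.
move=> /linear_linfun fE; rewrite -fE !lfunE /= /tlift_fun linear_sum.
apply: eq_bigr => i _; rewrite linear_sum; apply: eq_bigr => j _.
by rewrite linearZ /= fE.
Qed.

Lemma eq_tlift U V W (B B' : U -> V -> W) t :
  (forall u v, B u v = B' u v) -> tlift B t = tlift B' t.
Proof.
move=> BB'; rewrite !lfunE; apply: eq_bigr => i _; apply: eq_bigr => j _.
by rewrite BB'.
Qed.

Lemma tlift_linear U V W Z (B : Z -> U -> V -> W) t :
  (forall u v, linear (fun z => B z u v)) -> linear (fun z => tlift (B z) t).
Proof.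
move=> lB k x y; rewrite !lfunE /= /tlift_fun scaler_sumr -big_split.
apply: eq_bigr => i _; rewrite scaler_sumr -big_split; apply: eq_bigr => j _.
by rewrite lB scalerDr !scalerA mulrC.
Qed.

Lemma tlift_comp U V W Z Y (B : U -> V -> W) (f : 'Hom(Z, U)) (g : 'Hom(Y, V)) t :
  bilin B -> tlift B (tmap f g t) = tlift (fun u v => B (f u) (g v)) t.
Proof.
move=> [Bl Br]; rewrite -[LHS]comp_lfunE; move: t; apply/lfunP/tens_ext => u v.
rewrite comp_lfunE tmapE !tlift_tensor //; split=> z k x y /=.
  by rewrite linearP Bl.
by rewrite linearP Br.
Qed.

Definition trilin U V W Z (F : U -> V -> W -> Z) : Prop :=
  [/\ forall v w, linear (fun u => F u v w), forall u w, linear (fun v => F u v w)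
    & forall u v, linear (F u v)].

Lemma tlift_tassoc U V W Z (F : U -> V -> W -> Z) t : trilin F ->
  tlift (fun u s => tlift (F u) s) (tassoc U V W t) =
  tlift (fun s w => tlift (fun u v => F u v w) s) t.
Proof.
move=> [F1 F2 F3]; rewrite -[LHS]comp_lfunE; move: t.
apply/lfunP/tens_ext3 => u v w; rewrite comp_lfunE tassocE.
rewrite !tlift_tensor //; do ?split=> *; do ?[exact: F1 | exact: F2 | exact: F3].
- by move=> ? ? ?; rewrite linearP.
- by apply: tlift_linear.
- by apply: tlift_linear.
- by move=> ? ? ?; rewrite linearP.
Qed.

Lemma tlift_exchange U V Y Z W (G : U -> V -> Y -> Z -> W) t t' :
  tlift (fun u v => tlift (fun p q => G u v p q) t) t' =
  tlift (fun p q => tlift (fun u v => G u v p q) t') t.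
Proof.
rewrite !lfunE /= /tlift_fun.
under eq_bigr => i _ do under eq_bigr => j _ do rewrite lfunE /= /tlift_fun.
under [RHS]eq_bigr => i _ do under eq_bigr => j _ do rewrite lfunE /= /tlift_fun.
under eq_bigr => i _ do under eq_bigr => j _ do rewrite scaler_sumr.
under eq_bigr => i _ do rewrite exchange_big /=.
rewrite exchange_big /=; apply: eq_bigr => k _.
under eq_bigr => i _ do under eq_bigr => j _ do rewrite scaler_sumr.
under eq_bigr => i _ do rewrite exchange_big /=.
rewrite exchange_big /=; apply: eq_bigr => l _.
rewrite scaler_sumr; apply: eq_bigr => i _.
rewrite scaler_sumr; apply: eq_bigr => j _.
by rewrite !scalerA mulrC.
Qed.

End LinearFunctions.

Section Sided.
Variables (K : fieldType) (H : hopfType K).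
Local Notation S := (antipode : 'End(H)).
Implicit Types (x y z g h : H) (a b c : dual H) (W : vectType K).

(* With s = true, the product and the coproduct are both reversed: every
   statement below then holds for H and for H^{op,cop}, which have the same
   antipode. *)
Variable s : bool.

Definition hmul x y := if s then y * x else x * y.

Definition dmul a b := if s then b * a else a * b.

(* The Sweedler sum of B(x_1, x_2) over the coproduct of x. *)
Definition sw W (B : H -> H -> W) x : W :=
  tlift (if s then fun u v => B v u else B) (comul x).

Lemma hmulA x y z : hmul x (hmul y z) = hmul (hmul x y) z.
Proof. by rewrite /hmul; case: s; rewrite mulrA. Qed.
Lemma hmul1 x : hmul x 1 = x.
Proof. by rewrite /hmul; case: s; rewrite ?mulr1 ?mul1r. Qed.
Lemma h1mul x : hmul 1 x = x.
Proof. by rewrite /hmul; case: s; rewrite ?mulr1 ?mul1r. Qed.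
Lemma dmulA a b c : dmul a (dmul b c) = dmul (dmul a b) c.
Proof. by rewrite /dmul; case: s; rewrite mulrA. Qed.
Lemma dmul1 a : dmul a 1 = a.
Proof. by rewrite /dmul; case: s; rewrite ?mulr1 ?mul1r. Qed.
Lemma d1mul a : dmul 1 a = a.
Proof. by rewrite /dmul; case: s; rewrite ?mulr1 ?mul1r. Qed.
Lemma dmulDr a b c : dmul a (b + c) = dmul a b + dmul a c.
Proof. by rewrite /dmul; case: s; rewrite ?mulrDl ?mulrDr. Qed.
Lemma dmulZl k a b : dmul (k *: a) b = k *: dmul a b.
Proof. by rewrite /dmul; case: s; rewrite -?scalerAl -?scalerAr. Qed.
Lemma dmulZr k a b : dmul a (k *: b) = k *: dmul a b.
Proof. by rewrite /dmul; case: s; rewrite -?scalerAl -?scalerAr. Qed.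
Lemma dmulBl a b c : dmul (a - b) c = dmul a c - dmul b c.
Proof. by rewrite /dmul; case: s; rewrite ?mulrBl ?mulrBr. Qed.
Lemma dmulBr a b c : dmul a (b - c) = dmul a b - dmul a c.
Proof. by rewrite /dmul; case: s; rewrite ?mulrBl ?mulrBr. Qed.
Lemma dmul0r a : dmul a 0 = 0.
Proof. by rewrite /dmul; case: s; rewrite ?mulr0 ?mul0r. Qed.

Lemma lin_id W : linear (fun x : W => x). Proof. by []. Qed.
Lemma lin_hmull (W : vectType K) (f : W -> H) y :
  linear f -> linear (fun t => hmul (f t) y).
Proof.
by move=> lf k u v; rewrite /hmul lf; case: s;
  rewrite ?mulrDl ?mulrDr -?scalerAl -?scalerAr.
Qed.
Lemma lin_hmulr (W : vectType K) (f : W -> H) y :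
  linear f -> linear (fun t => hmul y (f t)).
Proof.
by move=> lf k u v; rewrite /hmul lf; case: s;
  rewrite ?mulrDl ?mulrDr -?scalerAl -?scalerAr.
Qed.
Lemma lin_lfun (U V W : vectType K) (g : 'Hom(V, W)) (f : U -> V) :
  linear f -> linear (fun t => g (f t)).
Proof. by move=> lf k u v; rewrite lf linearP. Qed.
Lemma lin_ev a (U : vectType K) (f : U -> H) :
  linear f -> linear (fun t => ev a (f t) : K^o).
Proof. by move=> lf k u v; rewrite lf evDr evZr. Qed.
Lemma lin_evZ a (U V : vectType K) (f : U -> H) (w : V) :
  linear f -> linear (fun t => ev a (f t) *: w).
Proof. by move=> lf k u v; rewrite lf evDr evZr scalerDl scalerA. Qed.
Lemma lin_scale (k : K) (U V : vectType K) (f : U -> V) :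
  linear f -> linear (fun t => k *: f t).
Proof. by move=> lf l u v; rewrite lf scalerDr !scalerA mulrC. Qed.
Lemma lin_sw (U W : vectType K) (B : H -> H -> W) (f : U -> H) :
  linear f -> linear (fun t => sw B (f t)).
Proof. by move=> lf; rewrite /sw; do 2!apply: lin_lfun. Qed.
Lemma lin_swB (U W : vectType K) (B : U -> H -> H -> W) x :
  (forall u v, linear (fun t => B t u v)) -> linear (fun t => sw (B t) x).
Proof. by move=> lB; rewrite /sw; case: s; apply: tlift_linear. Qed.

Lemma eq_sw W (B B' : H -> H -> W) x :
  (forall u v, B u v = B' u v) -> sw B x = sw B' x.
Proof. by move=> BB'; rewrite /sw; case: s; apply: eq_tlift. Qed.

Lemma sw_apply W (V : vectType K) (f : W -> V) (B : H -> H -> W) x :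
  linear f -> f (sw B x) = sw (fun u v => f (B u v)) x.
Proof. by move=> lf; rewrite /sw; case: s; apply: tlift_apply. Qed.

Lemma ev_sw a (B : H -> H -> H) x :
  ev a (sw B x) = sw (fun u v => ev a (B u v) : K^o) x.
Proof. by apply: (sw_apply (f := fun u => ev a u : K^o));
  exact: (lin_ev a (f := id)). Qed.

Lemma sw_coassoc W (F : H -> H -> H -> W) x : trilin F ->
  sw (fun u v => sw (fun p q => F p q v) u) x =
  sw (fun u v => sw (fun p q => F u p q) v) x.
Proof.
have coassoc (G : H -> H -> H -> W) : trilin G ->
    tlift (fun u v => tlift (fun p q => G p q v) (comul u)) (comul x) =
    tlift (fun u v => tlift (fun p q => G u p q) (comul v)) (comul x).
  move=> Gtri; have [G1 G2 G3] := Gtri.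
  transitivity (tlift (fun t w => tlift (fun u v => G u v w) t)
      (tmap comul \1 (comul x))).
    rewrite tlift_comp; first by apply: eq_tlift => u v; rewrite id_lfunE.
    split=> [y|t]; [exact: lin_hom | exact: tlift_linear].
  rewrite -tlift_tassoc // comulA tlift_comp.
    by apply: eq_tlift => u v; rewrite id_lfunE.
  split=> [t|u]; [by apply: tlift_linear | exact: lin_hom].
rewrite /sw => -[F1 F2 F3]; case: s; last exact: coassoc.
by rewrite (coassoc (fun u v w => F w v u)).
Qed.

Lemma sw_exchange W (G : H -> H -> H -> H -> W) x y :
  sw (fun u v => sw (fun p q => G u v p q) y) x =
  sw (fun p q => sw (fun u v => G u v p q) x) y.
Proof. by rewrite /sw; case: s; apply: tlift_exchange. Qed.

Lemma lin0 (U V : vectType K) (f : U -> V) : linear f -> f 0 = 0.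
Proof. by move=> /linear_linfun <-; rewrite linear0. Qed.

Lemma linZ (U V : vectType K) (f : U -> V) k u : linear f -> f (k *: u) = k *: f u.
Proof. by move=> /linear_linfun lf; rewrite -!lf linearZ. Qed.

Lemma sw_counitl W (f : H -> W) x :
  linear f -> sw (fun u v => ev 1 u *: f v) x = f x.
Proof.
move=> lf; transitivity (f (sw (fun u v => ev 1 u *: v) x)).
  by rewrite sw_apply //; apply: eq_sw => u v; rewrite linZ.
congr f; rewrite /sw; case: s; [exact: counitr | exact: counitl].
Qed.

Lemma sw_counitr W (f : H -> W) x :
  linear f -> sw (fun u v => ev 1 v *: f u) x = f x.
Proof.
move=> lf; transitivity (f (sw (fun u v => ev 1 v *: u) x)).
  by rewrite sw_apply //; apply: eq_sw => u v; rewrite linZ.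
congr f; rewrite /sw; case: s; [exact: counitl | exact: counitr].
Qed.

Lemma sw_mul W (B : H -> H -> W) x y : bilin B ->
  sw B (hmul x y) =
  sw (fun u v => sw (fun p q => B (hmul u p) (hmul v q)) y) x.
Proof.
have mul (G : H -> H -> W) z t : bilin G -> tlift G (comul (z * t)) =
    tlift (fun u v => tlift (fun p q => G (u * p) (v * q)) (comul t)) (comul z).
  move=> [Gl Gr]; rewrite comulM /tens_mul tlift_apply; last exact: lin_hom.
  apply: eq_tlift => u v; rewrite tlift_apply; last exact: lin_hom.
  by apply: eq_tlift => p q; rewrite tlift_tensor.
move=> [Bl Br]; rewrite /sw /hmul; case: s; last exact: mul.
by rewrite mul // tlift_exchange.
Qed.

Lemma sw_antipodel W (f : H -> W) x :
  linear f -> sw (fun u v => f (hmul (S u) v)) x = ev 1 x *: f 1.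
Proof.
move=> lf; rewrite -sw_apply // -linZ //; congr f; rewrite /sw /hmul; case: s.
  rewrite -antipoder /mulmap tlift_comp; first by apply: eq_tlift => u v;
    rewrite id_lfunE.
  by split=> z k u v; rewrite ?mulrDl ?mulrDr -?scalerAl -?scalerAr.
rewrite -antipodel /mulmap tlift_comp; first by apply: eq_tlift => u v;
  rewrite id_lfunE.
by split=> z k u v; rewrite ?mulrDl ?mulrDr -?scalerAl -?scalerAr.
Qed.

Lemma sw_antipoder W (f : H -> W) x :
  linear f -> sw (fun u v => f (hmul u (S v))) x = ev 1 x *: f 1.
Proof.
move=> lf; rewrite -sw_apply // -linZ //; congr f; rewrite /sw /hmul; case: s.
  rewrite -antipodel /mulmap tlift_comp; first by apply: eq_tlift => u v;
    rewrite id_lfunE.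
  by split=> z k u v; rewrite ?mulrDl ?mulrDr -?scalerAl -?scalerAr.
rewrite -antipoder /mulmap tlift_comp; first by apply: eq_tlift => u v;
  rewrite id_lfunE.
by split=> z k u v; rewrite ?mulrDl ?mulrDr -?scalerAl -?scalerAr.
Qed.

Lemma ev_dmul a b x :
  ev (dmul a b) x = sw (fun u v => ev a u *: (ev b v : K^o)) x.
Proof.
rewrite /dmul /sw; case: s; rewrite evM /functional_tensor //.
by apply: (@eq_tlift K H H K^o) => u v; apply: mulrC.
Qed.

Lemma sw_grouplike W (B : H -> H -> W) g :
  bilin B -> is_grouplike g -> sw B g = B g g.
Proof.
move=> [Bl Br] /andP[/eqP gg _]; rewrite /sw gg.
by case: s; rewrite tlift_tensor.
Qed.


Lemma lin_bilinl (U V W Z : vectType K) (B : U -> V -> W) (f : Z -> U) (w : V) :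
  bilin B -> linear f -> linear (fun t => B (f t) w).
Proof. by move=> [Bl Br] lf k u v; rewrite lf Bl. Qed.
Lemma lin_bilinr (U V W Z : vectType K) (B : U -> V -> W) (f : Z -> V) (w : U) :
  bilin B -> linear f -> linear (fun t => B w (f t)).
Proof. by move=> [Bl Br] lf k u v; rewrite lf Br. Qed.

Ltac lin := cbv beta;
  repeat first
    [ exact: lin_id | exact: lin_hom | assumption | apply: lin_hmull | apply: lin_hmulr
    | apply: lin_sw | (apply: lin_swB => ? ?) | apply: lin_lfun | apply: lin_evZ
    | apply: lin_scale | apply: lin_ev
    | (apply: lin_bilinl; [eassumption|]) | (apply: lin_bilinr; [eassumption|]) ].
Ltac multilin := split=> ? *; lin.

(** In the convolution algebra of maps from [H] to H ⊗ H, both the coproduct after S and the flipped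
    (S ⊗ S) after the coproduct are inverse to the coproduct. [F] is the product of the second map,
    the coproduct and the first map, read through [B]. *)
Lemma sw_antipode W (B : H -> H -> W) x :
  bilin B -> sw B (S x) = sw (fun u v => B (S v) (S u)) x.
Proof.
move=> Bbil.
pose M (u v y z : H) := sw (fun e f => sw (fun p q =>
  B (hmul (hmul (S v) e) p) (hmul (hmul (S u) f) q)) (S z)) y.
pose F (t y z : H) := sw (fun u v => M u v y z) t.
have Ftri : trilin F by rewrite /F /M; multilin.
(* Bracketed to the left, the first two factors cancel. *)
transitivity (sw (fun t z => sw (fun u v => F u v z) t) x).
  rewrite -[LHS](sw_counitl (f := fun y => sw B (S y))); last by lin.
  apply: eq_sw => t z; rewrite /F.
  rewrite (sw_coassoc (F := fun u v y => M u v y z)); last by rewrite /M; multilin.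
  transitivity (sw (fun u y => sw (fun p q => B p (hmul (hmul (S u) y) q)) (S z)) t).
    rewrite (sw_antipodel (f := fun y => sw (fun p q => B p (hmul y q)) (S z)));
      last by lin.
    by congr (_ *: _); apply: eq_sw => p q; rewrite h1mul.
  apply: eq_sw => u y; rewrite /M.
  rewrite -(sw_coassoc (F := fun v e f => sw (fun p q =>
    B (hmul (hmul (S v) e) p) (hmul (hmul (S u) f) q)) (S z))); last by multilin.
  rewrite -[LHS](sw_counitl (f := fun y => sw (fun p q =>
    B p (hmul (hmul (S u) y) q)) (S z))); last by lin.
  apply: eq_sw => m f.
  rewrite (sw_antipodel (f := fun m => sw (fun p q =>
    B (hmul m p) (hmul (hmul (S u) f) q)) (S z))); last by lin.
  by congr (_ *: _); apply: eq_sw => p q; rewrite h1mul.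
(* Bracketed to the right, the last two factors cancel. *)
rewrite sw_coassoc // -[RHS](sw_counitr (f := fun y => sw (fun u v =>
  B (S v) (S u)) y)); last by lin.
apply: eq_sw => t r; rewrite /F sw_exchange; cbv beta.
transitivity (sw (fun u v => ev 1 r *: B (S v) (S u)) t); last first.
  by rewrite -(sw_apply (f := fun y : W => ev 1 r *: y)) //; lin.
apply: eq_sw => u v; rewrite /M.
transitivity (sw (fun y z => sw (fun m n =>
  B (hmul (S v) m) (hmul (S u) n)) (hmul y (S z))) r).
  apply: eq_sw => y z; rewrite sw_mul; last by multilin.
  by apply: eq_sw => e f; apply: eq_sw => p q; rewrite !hmulA.
rewrite (sw_antipoder (f := fun y => sw (fun m n =>
  B (hmul (S v) m) (hmul (S u) n)) y)); last by lin.
rewrite sw_grouplike ?hmul1 //; first by multilin.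
by rewrite /is_grouplike comul1 counit1 !eqxx.
Qed.

(** The actions of the dual algebra on [H] that are transpose to right and to left multiplication in
    the sense of [dmul], see [ev_ract] and [ev_lact]. *)
Definition ract a x : H := sw (fun u v => ev a v *: u) x.
Definition lact a x : H := sw (fun u v => ev a u *: v) x.

Lemma ev_ract a b x : ev b (ract a x) = ev (dmul b a) x.
Proof.
rewrite ev_sw ev_dmul; apply: (@eq_sw K^o) => u v; rewrite evZr.
exact: (mulrC (ev a v) (ev b u)).
Qed.

Lemma ev_lact a b x : ev b (lact a x) = ev (dmul a b) x.
Proof. by rewrite ev_sw ev_dmul; apply: (@eq_sw K^o) => u v; rewrite evZr. Qed.

Lemma lin_ract a : linear (ract a). Proof. by rewrite /ract; lin. Qed.

(* For g = 1 this is a one-sided integral on H. *)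
Definition is_integral g lambda : Prop := forall b, dmul lambda b = ev b g *: lambda.

Lemma lact_integral g lambda x :
  is_integral g lambda -> lact lambda x = ev lambda x *: g.
Proof. by move=> lg; apply: ev_sep => b; rewrite ev_lact lg evZl evZr mulrC. Qed.

Lemma integral_lact g lambda :
  (forall x, lact lambda x = ev lambda x *: g) -> is_integral g lambda.
Proof. by move=> lg b; apply: ev_inj => x; rewrite -ev_lact lg evZl evZr mulrC. Qed.

(** The inverse of [g] is [S g]. For [h = hmul g x], the identity λ(h_1) h_2 = λ(h) g, multiplied by
    [S g] on the left, becomes the integral identity of weight 1 for [lambda']. *)
Lemma integral_translate g lambda : is_grouplike g -> is_integral g lambda ->
  exists2 lambda', is_integral 1 lambda' & forall x, ev lambda' x = ev lambda (hmul g
    x).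
Proof.
move=> gg lg; pose lambda' : dual H := linfun (fun x => ev lambda (hmul g x) : K^o).
have lE x : ev lambda' x = ev lambda (hmul g x).
  by rewrite /lambda' /ev linear_linfun //; apply: (lin_ev lambda (f := hmul g)); lin.
exists lambda' => //; apply: integral_lact => x; rewrite lE.
have [_ g1] := (is_grouplikeP g).1 gg.
have Sg : hmul (S g) g = 1.
  have := sw_antipodel g (lin_id (W := H)).
  by rewrite sw_grouplike // ?g1 ?scale1r //; multilin.
rewrite -Sg -(linZ (f := hmul (S g))); last by lin.
rewrite -lact_integral // /lact sw_mul; last by multilin.
rewrite (sw_grouplike (g := g)) //; last by multilin.
rewrite (sw_apply (f := hmul (S g))); last by lin.
apply: eq_sw => u v; rewrite lE (linZ (f := hmul (S g))); last by lin.
by rewrite hmulA Sg h1mul.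
Qed.

(** Both sides are equal to the sum of λ(x_1 y_1) x_2 y_2 S(y_3): either y_2 S(y_3) collapses by the
    antipode axiom, or the integral property is applied to x y_1. *)
Lemma integral_shift lambda x y : is_integral 1 lambda ->
  sw (fun u v => ev lambda (hmul u y) *: v) x =
  sw (fun p q => ev lambda (hmul x p) *: S q) y.
Proof.
move=> l1; transitivity (sw (fun t q => sw (fun u v => sw (fun p r =>
    ev lambda (hmul u p) *: hmul v (hmul r (S q))) t) x) y).
  rewrite sw_exchange.
  rewrite -[LHS](sw_apply (f := id)) //; apply: eq_sw => u v.
  rewrite (sw_coassoc (F := fun p r q =>
    ev lambda (hmul u p) *: hmul v (hmul r (S q)))); last by multilin.
  rewrite -[LHS](sw_counitr (f := fun y => ev lambda (hmul u y) *: v)); last by lin.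
  apply: eq_sw => p q.
  rewrite (sw_antipoder (f := fun y => ev lambda (hmul u p) *: hmul v y)); last by lin.
  by rewrite hmul1.
apply: eq_sw => t q.
rewrite -[S q in RHS]h1mul -(linZ (f := hmul^~ (S q))); last by lin.
rewrite -lact_integral // /lact sw_mul; last by multilin.
rewrite (sw_apply (f := hmul^~ (S q))); last by lin.
apply: eq_sw => u v; rewrite (sw_apply (f := hmul^~ (S q))); last by lin.
apply: eq_sw => p r; rewrite (linZ (f := hmul^~ (S q))); last by lin.
by rewrite hmulA.
Qed.


(** * Maschke's theorem, nondegeneracy and uniqueness of integrals *)

Lemma eq_sw_subcoalg W (B B' : H -> H -> W) (D : {vspace H}) x :
  is_subcoalg D -> x \in D -> bilin B -> bilin B' ->
  (forall u v, u \in D -> v \in D -> B u v = B' u v) -> sw B x = sw B' x.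
Proof.
move=> sD xD [Bl Br] [Bl' Br'] BB'; apply/eqlfunP.
have xDD : comul x \in tensv D D by apply: (subvP sD); apply: memv_img.
apply: (subvP _) xDD; apply: tensvP => u v uD vD; apply/eqlfunP.
by case: s; rewrite !tlift_tensor ?BB'.
Qed.

Lemma sw_sum W n (F : 'I_n -> H -> H -> W) x :
  sw (fun u v => \sum_i F i u v) x = \sum_i sw (F i) x.
Proof.
have sum t G : tlift (fun u v : H => \sum_i (G i u v : W)) t = \sum_(i < n) tlift (G
  i) t.
  under [RHS]eq_bigr do rewrite lfunE /= /tlift_fun.
  rewrite lfunE /= /tlift_fun [RHS]exchange_big; apply: eq_bigr => i _.
  rewrite [RHS]exchange_big; apply: eq_bigr => j _.
  by rewrite scaler_sumr.
by rewrite /sw; case: s => //; rewrite (sum _ (fun i u v => F i v u)).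
Qed.

Lemma sw_subcoalg W (B : H -> H -> W) (D : {vspace H}) x :
  is_subcoalg D -> x \in D -> bilin B ->
  (forall u v, u \in D -> v \in D -> B u v = 0) -> sw B x = 0.
Proof.
move=> sD xD Bbil B0; pose Z (u v : H) := 0 : W.
have Zbil : bilin Z by split=> ? k ? ?; rewrite scaler0 addr0.
rewrite (eq_sw_subcoalg sD xD Bbil Zbil) // -[LHS](sw_apply (f := fun y : W =>
  0 : W)) //.
by move=> k u v; rewrite scaler0 addr0.
Qed.

(** The hypotheses put the Sweedler legs of [x] in N and D: when the second leg is expanded in a
    basis of [D], the first legs that occur are the elements [ract (c i) x]. *)
Lemma sw_ract0 W (B : H -> H -> W) (N D : {vspace H}) x :
  is_subcoalg D -> x \in D -> bilin B -> (forall a, ract a x \in N) ->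
  (forall u v, u \in N -> v \in D -> B u v = 0) -> sw B x = 0.
Proof.
move=> sD xD Bbil xN B0.
pose c i : dual H := linfun (fun v => coord (vbasis D) i (projv D v) : K^o).
have cE i v : ev (c i) v = coord (vbasis D) i (projv D v).
  by rewrite /ev linear_linfun // => k y z; rewrite !linearP.
rewrite (eq_sw_subcoalg (B' := fun u v =>
  \sum_i ev (c i) v *: B u (vbasis D)`_i) sD xD) //.
- rewrite sw_sum big1 // => i _.
  rewrite -[RHS](B0 (ract (c i) x) (vbasis D)`_i) //; last first.
    by rewrite vbasis_mem // mem_nth ?size_tuple.
  rewrite /ract (sw_apply (f := fun u => B u (vbasis D)`_i)); last by lin.
  by apply: eq_sw => u v; rewrite (linZ (f := fun u => B u (vbasis D)`_i)); last by lin.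
- split=> [v|u] k y z.
    rewrite scaler_sumr -big_split; apply: eq_bigr => i _.
    by rewrite Bbil.1 scalerDr !scalerA mulrC.
  rewrite scaler_sumr -big_split; apply: eq_bigr => i _.
  by rewrite evDr evZr scalerDl scalerA.
move=> u v uD vD; rewrite {1}(coord_vbasis vD).
rewrite -[LHS](linear_linfun (f := B u)); last by lin.
rewrite linear_sum; apply: eq_bigr => i _.
by rewrite linearZ /= linear_linfun; [rewrite cE projv_id | lin].
Qed.

Lemma ract_subcoalg (D : {vspace H}) a x :
  is_subcoalg D -> x \in D -> ract a x \in D.
Proof.
move=> sD xD; apply: contraT => /functional_separates[b bx bD].
case: bx; rewrite -[LHS]/(ev b (ract a x)) ev_sw.
apply: (sw_subcoalg sD xD) => [|u v uD vD]; first by multilin.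
by rewrite evZr -[ev b u]/((b : 'Hom(H, K^o)) u) bD // mulr0.
Qed.

(** [N] is the orthogonal of [D] for the form λ(x S(z)). It is stable by [integral_shift], because
    the antipode reverses the coproduct and [D] is a subcoalgebra. *)
Lemma maschke lambda (D : {vspace H}) :
    is_integral 1 lambda -> ev lambda 1 = 1 -> is_subcoalg D -> D != fullv ->
  exists N : {vspace H}, [/\ N != 0%VS, forall a x, x \in N -> ract a x \in N
    & (N :&: D = 0)%VS].
Proof.
move=> l1 l11 sD nD.
pose phi : 'Hom(H, {ffun 'I_(\dim D) -> K^o}) :=
  linfun (fun x => [ffun i : 'I_(\dim D) =>
    (ev lambda (hmul x (S (vbasis D)`_i)) : K^o)]).
have phiE x : phi x = [ffun i : 'I_(\dim D) =>
  (ev lambda (hmul x (S (vbasis D)`_i)) : K^o)].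
  rewrite linear_linfun // => k u v; apply/ffunP => i; rewrite !ffunE.
  by rewrite /hmul; case: (s); rewrite ?mulrDl ?mulrDr -?scalerAl -?scalerAr evDr evZr.
have memN x : reflect (forall z, z \in D ->
  ev lambda (hmul x (S z)) = 0) (x \in lker phi).
  rewrite memv_ker; apply: (iffP eqP) => [x0 z zD|x0].
    rewrite (coord_vbasis zD) linear_sum.
    have lx : linear (fun y => ev lambda (hmul x y) : K^o).
      by apply: (lin_ev lambda (f := hmul x)); lin.
    rewrite -[LHS](linear_linfun lx) linear_sum big1 // => i _.
    rewrite !linearZ /= linear_linfun //.
    have /ffunP/(_ i) := x0; rewrite phiE !ffunE => ->.
    by rewrite scaler0.
  by rewrite phiE; apply/ffunP => i; rewrite !ffunE x0 // vbasis_mem //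
    mem_nth ?size_tuple.
have Nstab a x : x \in lker phi -> ract a x \in lker phi.
  move=> xN; apply/memN => z zD.
  transitivity (ev a (sw (fun u v => ev lambda (hmul u (S z)) *: v) x)).
    rewrite ev_sw; pose f y : K^o := ev lambda (hmul y (S z)).
    have lf : linear f by apply: (lin_ev lambda (f := hmul^~ (S z))); lin.
    rewrite -[LHS]/(f (ract a x)) /ract sw_apply //.
    apply: (@eq_sw K^o) => u v; rewrite linZ // evZr; exact: mulrC.
  rewrite integral_shift // sw_antipode; last by multilin.
  rewrite (sw_subcoalg sD zD) ?ev0r //; first by multilin.
  by move=> u v uD vD; rewrite (memN x xN) ?scale0r.
(* [N] is cut out by dim D linear conditions, fewer than dim H, so it is nonzero. *)
exists (lker phi); split=> //.
  rewrite -dimv_eq0 -lt0n; have := limg_ker_dim phi fullv; rewrite capfv => dimE.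
  have : (\dim (limg phi) <= \dim D)%N.
    by rewrite (leq_trans (dimvS (subvf _))) // dimvf /dim /= card_ord muln1.
  have : (\dim D < \dim {:H})%N.
    by rewrite ltnNge; apply: contra nD => dD; rewrite eqEdim subvf.
  by rewrite -dimE; case: (\dim (lker phi)) => [|m] //; rewrite add0n ltnNge => /negP.
(* On the intersection the counit is ε(x) = λ(x_1 S(x_2)), with x_1 in [N] and x_2 in [D], so it
   vanishes. Applied to all [ract a x], this gives [x = 0]. *)
have ev1ND x : x \in lker phi -> x \in D -> ev 1 x = 0.
  move=> xN xD; have := sw_antipoder x (lin_ev lambda (lin_id (W := H))).
  rewrite l11 -[_ *: 1]/(ev 1 x * 1) mulr1 => <-.
  apply: (@sw_ract0 K^o _ (lker phi) D x sD xD) => [|a|u v uN vD]; first by multilin.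
    exact: Nstab.
  exact: (memN u uN).
apply/eqP; rewrite -subv0; apply/subvP => x /memv_capP[xN xD].
rewrite memv0; apply/eqP/ev_sep => a; rewrite ev0r -[a]d1mul -ev_ract ev1ND //.
  exact: Nstab.
exact: ract_subcoalg.
Qed.


(** The kernel [P] of the form λ(z y) is stable under [ract] by [integral_shift]. Hence ε(z) λ(y) =
    λ(z_1 S(z_2) y) = 0 for [z] in the kernel, so the counit vanishes on it, and stability then
    makes every functional vanish. *)
Lemma integral_nondegenerate lambda x : is_integral 1 lambda -> lambda != 0 ->
  (forall y, ev lambda (hmul x y) = 0) -> x = 0.
Proof.
move=> l1 l0; pose P z := forall y, ev lambda (hmul z y) = 0.
have linl y : linear (fun z => ev lambda (hmul z y) : K^o).
  by apply: (lin_ev lambda (f := hmul^~ y)); lin.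
have Psub : submod_pred P.
  split=> [y|k u v Pu Pv y]; first by rewrite (lin0 (linl y)).
  by rewrite (linl y) Pu Pv scaler0 addr0.
have Pract a z : P z -> P (ract a z).
  move=> Pz y; transitivity (ev a (sw (fun u v => ev lambda (hmul u y) *: v) z)).
    rewrite ev_sw; pose f u : K^o := ev lambda (hmul u y).
    have lf : linear f := linl y.
    rewrite -[LHS]/(f (ract a z)) /ract sw_apply //.
    apply: (@eq_sw K^o) => u v; rewrite linZ // evZr; exact: mulrC.
  rewrite integral_shift // (_ : sw _ _ = sw (fun _ _ => 0 : H) y).
    have lin00 : linear (fun _ : H => 0 : H) by move=> k u v; rewrite scaler0 addr0.
    by rewrite -(sw_apply (fun u _ => u) y lin00) ev0r.
  by apply: eq_sw => u v; rewrite Pz scale0r.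
have sub_full : is_subcoalg (fullv : {vspace H}).
  apply/subvP => t _; rewrite [t]tensor_basis; apply: rpred_sum => i _.
  by apply: rpred_sum => j _; rewrite rpredZ // mem_tensv ?memvf.
have P1 z : P z -> ev 1 z = 0.
  move=> Pz; have [y ly] : exists y, ev lambda y != 0.
    apply: contrapT => /forallNP ly; case/eqP: l0; apply: ev_inj => y.
    by rewrite ev0l; apply/eqP; apply: contra_notT (ly y).
  apply/eqP; suff: ev 1 z * ev lambda y == 0 by rewrite mulf_eq0 (negPf ly) orbF.
  have := sw_antipoder z (linl y); rewrite h1mul -[_ *: _]/(ev 1 z * ev lambda y) => <-.
  apply/eqP; apply: (@sw_ract0 K^o _ (vspace_of P) fullv z sub_full (memvf z)).
  - by multilin.
  - by move=> a; apply/mem_vspace_of => //; apply: Pract.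
  by move=> u v /mem_vspace_of-/(_ Psub) Pu _; rewrite -hmulA Pu.
move=> Px; apply: ev_sep => a; rewrite ev0r -[a]d1mul -ev_ract; exact/P1/Pract.
Qed.

(** By nondegeneracy λ'(x) = λ(x y) for some fixed [y]; the integral properties force this [y] to be
    a scalar. *)
Lemma integral_unique lambda lambda' : is_integral 1 lambda -> lambda != 0 ->
  is_integral 1 lambda' -> exists c : K, lambda' = c *: lambda.
Proof.
move=> l1 l0 l1'; pose F : 'Hom(H, dual H) := linfun (fun x : H =>
  (linfun (fun y => ev lambda (hmul x y) : K^o) : dual H)).
have FE x y : ev (F x) y = ev lambda (hmul x y).
  have lE z t : ev (linfun (fun y => ev lambda (hmul z y) : K^o) : dual H) t
              = ev lambda (hmul z t).
    by rewrite /ev linear_linfun //; apply: (lin_ev lambda (f := hmul z)); lin.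
  rewrite linear_linfun // => k u v; apply: ev_inj => z; rewrite evDl evZl !lE.
  by apply: (lin_ev lambda (f := hmul^~ z)); lin.
have F0 : lker F == 0%VS.
  rewrite -subv0; apply/subvP => x; rewrite memv_ker memv0 => /eqP Fx.
  by apply/eqP/(integral_nondegenerate l1 l0) => y; rewrite -FE Fx ev0l.
have Ffull : limg F = fullv.
  apply/eqP; rewrite eqEdim subvf limg_dim_eq ?(eqP F0) ?capv0 //.
  by rewrite !dimvf /dim /= muln1.
have Fonto b : exists x, F x = b.
  by have := memvf b; rewrite -Ffull => /memv_imgP[x _ ->]; exists x.
have [y yE] : exists y, forall b, ev b y = ev lambda' (F^-1%VF b).
  by apply: ev_onto => k a b; rewrite linearP evDr evZr.
have {}yE x : ev lambda (hmul x y) = ev lambda' x by rewrite -FE yE lker0_lfunK.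
(* By [integral_shift] and the integral property of [lambda'], the sum of λ(x y_1) S(y_2) is λ(x y)
   1 for all x. Nondegeneracy removes λ and x. *)
have yS f : sw (fun p q => ev f (S q) *: p) y = ev f 1 *: y.
  apply: ev_sep => b; have [x <-] := Fonto b; rewrite !FE.
  pose h z : K^o := ev lambda (hmul x z).
  have lx : linear h by apply: (lin_ev lambda (f := hmul x)); lin.
  rewrite -[LHS]/(h _) -[RHS]/(h _) (linZ _ _ lx) /h yE.
  have := lact_integral x l1'; move/(congr1 (ev f)); rewrite evZr [_ *: _]mulrC => <-.
  rewrite /lact; transitivity (ev f (sw (fun u v => ev lambda (hmul u y) *: v) x)).
    rewrite integral_shift // ev_sw.
    rewrite -[LHS]/(h _) sw_apply //.
    by apply: (@eq_sw K^o) => p q; rewrite linZ // evZr; apply: mulrC.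
  by congr (ev f _); apply: eq_sw => u v; rewrite yE.
have {}yS : sw (fun p q => p ⊗ S q) y = y ⊗ 1.
  apply: functional_tensor_sep => a b; rewrite functional_tensorE.
  rewrite -[a y]/(ev a y) -[b 1]/(ev b 1).
  have := congr1 (ev a) (yS b); rewrite evZr [_ *: _]mulrC => <-.
  rewrite ev_sw (sw_apply (f := functional_tensor a b)); last exact: lin_hom.
  by apply: (@eq_sw K^o) => p q; rewrite functional_tensorE evZr; apply: mulrC.
have hbil : bilin hmul by multilin.
(* Multiplying the two legs of y_1 ⊗ S(y_2) = y ⊗ 1 gives ε(y) 1 = y. *)
have y1 : y = ev 1 y *: 1.
  rewrite -(sw_antipoder y (lin_id (W := H))) -[LHS]hmul1.
  rewrite -[LHS](tlift_tensor _ _ hbil) -yS (sw_apply (f := tlift hmul));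
    last exact: lin_hom.
  by apply: eq_sw => p q; rewrite tlift_tensor.
exists (ev 1 y); apply: ev_inj => x; rewrite -yE {1}y1 evZl.
by rewrite /hmul; case: (s); rewrite -?scalerAl -?scalerAr ?mulr1 ?mul1r evZr.
Qed.

End Sided.

(** * The coradical and the radical of the dual *)

Section Radical.
Variables (K : fieldType) (H : hopfType K).
Implicit Types (x y z g h : H) (a b c : dual H) (D E : {vspace H}).

Definition annihilator D : {vspace dual H} :=
  vspace_of (fun a => forall x, x \in D -> ev a x = 0).

Lemma annihilatorP D a :
  (a \in annihilator D) <-> (forall x, x \in D -> ev a x = 0).
Proof.
apply: mem_vspace_of; split=> [x _|k b c b0 c0 x xD]; first by rewrite ev0l.
by rewrite evDl evZl b0 ?c0 // mulr0 addr0.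
Qed.

Definition dual_orthogonal (M : {vspace dual H}) : {vspace H} :=
  vspace_of (fun x => forall a, a \in M -> ev a x = 0).

Lemma dual_orthogonalP M x :
  (x \in dual_orthogonal M) <-> (forall a, a \in M -> ev a x = 0).
Proof.
apply: mem_vspace_of; split=> [a _|k y z y0 z0 a aM]; first by rewrite ev0r.
by rewrite evDr evZr y0 ?z0 // mulr0 addr0.
Qed.

Lemma annihilatorK D x : (forall a, a \in annihilator D -> ev a x = 0) -> x \in D.
Proof.
move=> xD; apply: contraT => /functional_separates[a ax aD].
by case: ax; apply: (xD (a : dual H)); apply/annihilatorP.
Qed.

Lemma dual_orthogonalK M a : (forall x, x \in dual_orthogonal M -> ev a x = 0) ->
  a \in M.
Proof.
move=> aM; apply: contraT => /functional_separates[F Fa FM]; case: Fa.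
have [x xE] : exists x, forall b, ev b x = (F b : K).
  by apply: ev_onto => k b c; rewrite linearP.
by rewrite -xE; apply: aM; apply/dual_orthogonalP => b bM; rewrite xE FM.
Qed.

Lemma subcoalg_annihilator D : is_subcoalg D -> is_ideal (annihilator D).
Proof.
move=> sD a c b /annihilatorP c0; apply/annihilatorP => x xD.
have l0 y : y \in D -> ev (a * c) y = 0.
  move=> yD; rewrite -[a * c]/(dmul false a c) ev_dmul.
  apply: (@sw_subcoalg K H false K^o _ D y sD yD) => [|u v _ vD];
    last by rewrite c0 // scaler0.
  by split=> w k u v; rewrite evDr evZr ?scalerDl ?scalerDr ?scalerA // mulrC.
rewrite -[a * c * b]/(dmul false (a * c) b) ev_dmul.
apply: (@sw_subcoalg K H false K^o _ D x sD xD) => [|u v uD _];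
  last by rewrite l0 // scale0r.
by split=> w k u v; rewrite evDr evZr ?scalerDl ?scalerDr ?scalerA // mulrC.
Qed.

(** With [q] a projection onto [D], each [a - a \o q] kills [D]. The annihilator being an ideal,
    [a * b] and [(a \o q) * (b \o q)] agree on [D], so the coproduct of an element of [D] is fixed
    by q ⊗ q. *)
Lemma annihilator_subcoalg D : is_ideal (annihilator D) -> is_subcoalg D.
Proof.
move=> idD; apply/subvP => t /memv_imgP[x xD ->].
pose q := projv D.
have -> : comul x = tmap q q (comul x).
  apply: functional_tensor_sep => a b; rewrite functional_tensor_tmap.
  have kill f : (f : dual H) - (f \o q)%VF \in annihilator D.
    apply/annihilatorP => y yD; rewrite evBl /ev comp_lfunE /q projv_id //.
    exact: subrr.
  set a' : dual H := (a \o q)%VF; set b' : dual H := (b \o q)%VF.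
  suff : ev ((a : dual H) * b) x = ev (a' * b') x by rewrite !evM.
  apply/eqP; rewrite -subr_eq0 -evBl.
  have -> : (a : dual H) * b - a' * b' = ((a : dual H) - a') * b + a' * ((b : dual H)
    - b').
    by rewrite mulrBl mulrBr addrA subrK.
  rewrite evDl; apply/eqP.
  have ka : (a : dual H) - a' \in annihilator D := kill a.
  have kb : (b : dual H) - b' \in annihilator D := kill b.
  have := idD a' _ 1 kb; rewrite mulr1 => /annihilatorP -> //.
  by have := idD 1 _ b ka; rewrite mul1r => /annihilatorP -> //; rewrite addr0.
rewrite [comul x]tensor_basis !linear_sum; apply: rpred_sum => i _.
rewrite linear_sum; apply: rpred_sum => j _; rewrite linearZ rpredZ //= tmapE.
by rewrite mem_tensv ?memv_proj.
Qed.

(** Orthogonality reverses inclusions and exchanges two-sided ideals of the dual with subcoalgebras,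
    so a subcoalgebra inside the orthogonal of [M] corresponds to an ideal above [M]. *)
Lemma max_ideal_simple M : is_max_ideal M -> is_simple_subcoalg (dual_orthogonal M).
Proof.
move=> [idM M1 maxM].
have ann_orth : annihilator (dual_orthogonal M) = M.
  apply/vspaceP => a; apply/idP/idP => [/annihilatorP/dual_orthogonalK // | aM].
  by apply/annihilatorP => x /dual_orthogonalP; apply.
split; first by apply: annihilator_subcoalg; rewrite ann_orth.
  apply: contra M1 => /eqP M0; rewrite -ann_orth M0; apply/annihilatorP => x.
  by rewrite memv0 => /eqP->; rewrite ev0r.
move=> E sE sED; have idE := subcoalg_annihilator sE.
have [E1|nE1] := boolP (1 \in annihilator E).
  left; apply/eqP; rewrite -subv0; apply/subvP => x xE; rewrite memv0.
  apply/eqP/ev_sep => a; rewrite ev0r; have := idE a 1 1 E1.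
  by rewrite !mulr1 => /annihilatorP ->.
right; apply/eqP; rewrite eqEsubv sED; apply/subvP => x /dual_orthogonalP xM.
apply: annihilatorK => a aE; apply: xM; rewrite -(maxM _ idE) //.
apply/subvP => b bM; apply/annihilatorP => y yE.
by have /dual_orthogonalP/(_ b bM) := subvP sED y yE.
Qed.

Definition radical := annihilator (coradical H).
Local Notation J := radical.

Lemma radical_ideal : is_ideal J.
Proof. exact: subcoalg_annihilator (coradical_subcoalg H). Qed.

Lemma simple_coradical D : is_simple_subcoalg D -> (D <= coradical H)%VS.
Proof. exact: (sumv_ofP (@is_simple_subcoalg K H)).1. Qed.

Lemma radical_nilpotent : exists m, (J ^+ m)%VS = 0%VS.
Proof.
apply: (nilpotent_radical radical_ideal) => M maxM.
apply/subvP => a /annihilatorP a0; apply: dual_orthogonalK => x xM; apply: a0.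
exact: (subvP (simple_coradical (max_ideal_simple maxM))).
Qed.

Lemma grouplike_coradical g : is_grouplike g -> g \in coradical H.
Proof.
move=> /[dup] gg /is_grouplikeP[gM g1].
apply: (subvP (simple_coradical _)) (memv_line g); split.
- apply/subvP => _ /memv_imgP[_ /vlineP[k ->] ->]; rewrite linearZ rpredZ //=.
  by have /andP[/eqP-> _] := gg; rewrite mem_tensv ?memv_line.
- apply/eqP => g0; have := memv_line g; rewrite g0 memv0 => /eqP g00.
  by move: g1; rewrite g00 ev0r => /eqP; rewrite eq_sym oner_eq0.
move=> E _ sE; have := dimvS sE; rewrite dim_vline.
case dE: (\dim E) => [|m] dle; [left | right]; first by apply/eqP; rewrite -dimv_eq0 dE.
by apply/eqP; rewrite eqEdim sE dim_vline dE (leq_trans (leq_b1 _)).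
Qed.

End Radical.

(** * The components of P_1 *)

Section Projection.
Variables (K : fieldType) (H : hopfType K).
Variable p : 'Hom(H, coradical_coalg H).
Hypothesis p_proj : is_coradical_proj p.
Implicit Types (x y z g h : H) (a b c : dual H).
Local Notation J := (radical H).

Definition qproj : 'End(H) := (coradical_incl H \o p)%VF.

Lemma qproj_mem x : qproj x \in coradical H.
Proof. by rewrite comp_lfunE subcoalg_incl_mem. Qed.

Lemma qproj_id x : x \in coradical H -> qproj x = x.
Proof.
move=> xC; have xE : coradical_incl H (subcoalg_proj (coradical_subcoalg H) x) = x.
  exact: subcoalg_projK.
by rewrite comp_lfunE -{1}xE (proj2 p_proj) xE.
Qed.

Lemma comul_qproj x : comul (qproj x) = tmap qproj qproj (comul x).
Proof.
rewrite comp_lfunE -subcoalg_comul_incl -[fun_of_lfun (subcoalg_comul _) _]/(comul (p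
  x)).
by rewrite (proj1 (proj1 p_proj)) tmap_comp.
Qed.

(** The transpose of the projection: an idempotent algebra endomorphism of [dual H] with kernel the
    radical, whose image is the copy of (H_0)^*. *)
Definition res a : dual H := (a \o qproj)%VF.

Lemma ev_res a x : ev (res a) x = ev a (qproj x).
Proof. by rewrite /ev comp_lfunE. Qed.

Lemma ev_res_id a x : x \in coradical H -> ev (res a) x = ev a x.
Proof. by move=> xC; rewrite ev_res qproj_id. Qed.

Lemma resM a b : res (a * b) = res a * res b.
Proof. exact/esym/(convolution_comp a b comul_qproj). Qed.

Lemma res1 : res 1 = 1.
Proof.
apply: ev_inj => x; rewrite ev_res !ev1 comp_lfunE -[RHS](proj2 (proj1 p_proj)).
by rewrite -[RHS]/(fun_of_lfun (subcoalg_counit _) _) comp_lfunE.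
Qed.

Lemma resK a : res (res a) = res a.
Proof. by apply: ev_inj => x; rewrite !ev_res qproj_id ?qproj_mem. Qed.

Lemma res_dmul s a b : res (dmul s a b) = dmul s (res a) (res b).
Proof. by case: s; apply: resM. Qed.

Lemma sub_res_radical a : a - res a \in J.
Proof. by apply/annihilatorP => x xC; rewrite evBl ev_res_id ?subrr. Qed.

Lemma ev_sub_res a x : ev (a - res a) x = ev a (x - qproj x).
Proof. by rewrite evBl ev_res evBr. Qed.

Lemma res_radical a : a \in J -> res a = 0.
Proof.
by move=> /annihilatorP a0; apply: ev_inj => x; rewrite ev_res a0 ?ev0l // qproj_mem.
Qed.

(** The defining equation of [P1] tested against pairs of functionals. It is symmetric under
    reversal of the product, so both values of [s] are available. *)
Lemma dmul_P1 s y : (y \in P1 p) <->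
  (forall a b, ev (dmul s a b) y = ev (dmul s (res a) b) y + ev (dmul s a (res b)) y).
Proof.
have P1E : (y \in P1 p) <->
    (forall a b, ev (a * b) y = ev (res a * b) y + ev (a * res b) y).
  have tE t a b : functional_tensor a b (tmap (coradical_incl H) \1 (tmap p \1 t)
        + tmap \1 (coradical_incl H) (tmap \1 p t)) =
      functional_tensor (res a) b t + functional_tensor a (res b) t.
    by rewrite linearD /= !functional_tensor_tmap -!comp_lfunA !comp_lfun1r.
  rewrite memP1 /rhoL /rhoR !comp_lfunE; split=> [yP a b|yP].
    by rewrite evM yP tE !evM.
  by apply: functional_tensor_sep => a b; rewrite tE -!evM.
rewrite P1E; case: s => //; split=> E a b; have := E b a; rewrite /dmul => ->;
  exact: addrC.
Qed.

(** On the pair [res a], [1] the equation of [P1] reads v = v + v. Thus the projection kills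
    [P1]. *)
Lemma P1_res y a : y \in P1 p -> ev (res a) y = 0.
Proof.
move=> /(dmul_P1 false)/(_ (res a) 1); rewrite res1 resK !dmul1 => /eqP.
by rewrite -subr_eq0 opprD addrA subrr sub0r oppr_eq0 => /eqP.
Qed.

Lemma P1_coradical0 y : y \in P1 p -> y \in coradical H -> y = 0.
Proof.
by move=> yP yC; apply: ev_sep => a; rewrite ev0r -(ev_res_id a yC) P1_res.
Qed.

(* On the coradical, E is a multiple of the coordinate of the grouplike h. *)
Definition is_weight h E : Prop :=
  res E = E /\ forall s a, dmul s (res a) E = ev a h *: E.

Section Component.
Variable s : bool.
Local Notation "a ∗ b" := (dmul s a b) (at level 40, left associativity).

(* The component P_1^{g,C} summed over all C when s = false, and P_1^{C,g} when
   s = true. *)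
Definition P1_comp g : {vspace H} := vspace_of (fun y =>
  y \in P1 p /\ forall a b, ev (res a ∗ b) y = ev a g * ev b y).

Lemma P1_compP g y : (y \in P1_comp g) <->
  (y \in P1 p /\ forall a b, ev (res a ∗ b) y = ev a g * ev b y).
Proof.
apply: mem_vspace_of; split=> [|k u v [uP uE] [vP vE]].
  by split=> [|a b]; rewrite ?mem0v // !ev0r mulr0.
split=> [|a b]; first by rewrite memvD ?memvZ.
by rewrite !evDr !evZr uE vE mulrDr mulrCA.
Qed.

Lemma P1_ract c y : res c = c -> y \in P1 p -> ract s c y \in P1 p.
Proof.
move=> cE /(dmul_P1 s) yP.
apply/(dmul_P1 s) => a b; rewrite !ev_ract -!dmulA yP; congr (_ + _).
by rewrite res_dmul cE.
Qed.

Lemma P1_comp_ract g c y : res c = c -> y \in P1_comp g -> ract s c y \in P1_comp g.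
Proof.
move=> cE /P1_compP[yP yE]; apply/P1_compP; split; first exact: P1_ract.
by move=> a b; rewrite !ev_ract -dmulA yE.
Qed.

(** The equation of [P1] for [x - qproj x] is the vanishing at [x] of the product of [a - res a] and
    [b - res b], expanded. *)
Lemma P1_of x :
  (forall i j, i \in J -> j \in J -> ev (i ∗ j) x = 0) -> x - qproj x \in P1 p.
Proof.
move=> x0; apply/(dmul_P1 s) => a b.
rewrite -!ev_sub_res !res_dmul !resK.
have := x0 _ _ (sub_res_radical a) (sub_res_radical b).
rewrite dmulBl !dmulBr !evBl => /eqP.
by rewrite subr_eq0 subr_eq => /eqP E; rewrite E addrA.
Qed.

Lemma P1_comp_of g x : is_grouplike g ->
    (forall a j, ev a g = 0 -> j \in J -> ev (a ∗ j) x = 0) ->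
  x - qproj x \in P1_comp g.
Proof.
move=> gg x0; have gC := grouplike_coradical gg.
have evE b : ev b (x - qproj x) = ev (b - res b) x by rewrite ev_sub_res.
apply/P1_compP; split.
  by apply: P1_of => i j /annihilatorP iJ jJ; apply: x0 => //; apply: iJ.
move=> a b; rewrite !evE res_dmul resK -dmulBr.
have a0 : ev (res a - ev a g *: 1) g = 0.
  by rewrite evBl evZl ev_res_id // ((is_grouplikeP g).1 gg).2 mulr1 subrr.
have /eqP := x0 _ _ a0 (sub_res_radical b).
by rewrite dmulBl dmulZl d1mul [ev (_ - _ *: _) _]evBl evZl subr_eq0 => /eqP.
Qed.

(** The element [ract s E y] has [g] on one side and [h] on the other, so it is skew primitive,
    hence in k[G]. But [P1] meets the coradical in 0. *)
Lemma P1_comp_weight g h E y :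
    (forall x, ~ @is_nontrivial_skew_primitive K H x) -> is_grouplike g ->
    is_grouplike h -> is_weight h E -> y \in P1_comp g -> ract s E y = 0.
Proof.
move=> noskew gg hh [resE Eh] yP; set z := ract s E y.
have /P1_compP[zP zg] : z \in P1_comp g by apply: P1_comp_ract.
have zh a b : ev (b ∗ res a) z = ev a h * ev b z.
  by rewrite /z !ev_ract -dmulA Eh dmulZr evZl.
have zM a b : ev (a ∗ b) z = ev a g * ev b z + ev a z * ev b h.
  by have /(dmul_P1 s) -> := zP; rewrite zg zh [ev b h * _]mulrC.
have zskew : is_skew_primitive z.
  have gG : g \in grouplikes H by rewrite mem_grouplikes.
  have hG : h \in grouplikes H by rewrite mem_grouplikes.
  rewrite /is_skew_primitive; clear - zM gG hG; move: zM; rewrite /dmul.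
  case: (s) => zM; [exists h, g | exists g, h]; split=> //;
    apply: functional_tensor_sep => a b;
    rewrite linearD /= !functional_tensorE -evM zM //.
  by rewrite addrC; congr (_ + _); apply: mulrC.
apply: contrapT => z0; apply: (noskew z); split=> //; apply/negP => zG.
apply: z0; apply: (P1_coradical0 zP); apply: (subvP _ _ zG).
apply/span_subvP => k; rewrite mem_grouplikes; exact: grouplike_coradical.
Qed.

(** The condition on [W] expresses J = A_g J, with A_g the functionals vanishing at [g]. Since [e]
    sends A_g into [J], each further factor [e] raises the power of [J] by one. *)
Lemma integral_of_weight g e : is_grouplike g -> is_weight g e -> ev e g = 1 ->
    (forall W : {vspace dual H},
       (forall a j, ev a g = 0 -> j \in J -> a ∗ j \in W) -> (J <= W)%VS) ->
  exists2 lambda, is_integral s g lambda & ev lambda g = 1.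
Proof.
move=> gg [rese eg] eg1 hJ; have [gM g1] := (is_grouplikeP g).1 gg.
have J_dmul a j : j \in J -> a ∗ j \in J.
  move=> jJ; rewrite /dmul; case: (s).
    by have := radical_ideal 1 a jJ; rewrite mul1r.
  by have := radical_ideal a 1 jJ; rewrite mulr1.
have eJ a : ev a g = 0 -> e ∗ a \in J.
  move=> a0; rewrite -{1}[a](subrK (res a)) dmulDr rpredD //.
    by rewrite J_dmul ?sub_res_radical.
  have := eg (~~ s) a; rewrite a0 scale0r.
  have -> : dmul (~~ s) (res a) e = e ∗ res a by case: (s).
  by move=> ->; rewrite mem0v.
have expS m a : e ^+ m.+1 ∗ a = e ^+ m ∗ (e ∗ a).
  by rewrite dmulA /dmul; case: (s); rewrite -?exprS -?exprSr.
have eXJ m : forall j, j \in J -> e ^+ m ∗ j \in (J ^+ m.+1)%VS.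
  elim: m => [|m IHm] j jJ; first by rewrite d1mul expv1.
  pose P j := e ^+ m.+1 ∗ j \in (J ^+ m.+2)%VS.
  have Psub : submod_pred P.
    by split=> [|k a b aP bP]; rewrite /P ?dmul0r ?mem0v // dmulDr dmulZr memvD ?memvZ.
  apply/(mem_vspace_of j Psub)/(subvP (hJ _ _) j jJ) => a i a0 iJ.
  apply/mem_vspace_of => //; rewrite /P expS (dmulA s e) dmulA.
  have bJ := IHm _ (eJ a a0); set b := e ^+ m ∗ (e ∗ a) in bJ *.
  by rewrite /dmul; case: (s); [rewrite expvSl | rewrite expvSr]; apply: memv_mul.
have [m Jm] := radical_nilpotent H.
(* One factor [e] brings [b - ev b g *: 1] into [J]; the other [m] factors push it into J^(m+1) =
   0. *)
exists (e ^+ m.+1) => [b|].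
  have b0 : ev (b - ev b g *: 1) g = 0 by rewrite evBl evZl g1 mulr1 subrr.
  have := eXJ m _ (eJ _ b0); rewrite expvSr Jm prod0v memv0 -expS.
  by rewrite dmulBr dmulZr dmul1 subr_eq0 => /eqP.
by elim: m {Jm} => [|m IHm]; rewrite ?expr1 // exprS gM eg1 mul1r.
Qed.

Lemma exists_extension g e : is_grouplike g -> is_weight g e -> ev e g = 1 ->
    ~~ cosemisimple H ->
  exists2 x, x \notin coradical H &
    forall a j, ev a g = 0 -> j \in J -> ev (a ∗ j) x = 0.
Proof.
move=> gg we eg1 ncoss; apply: contrapT => nx.
have hJ (W : {vspace dual H}) :
    (forall a j, ev a g = 0 -> j \in J -> a ∗ j \in W) -> (J <= W)%VS.
  move=> WP; apply/subvP => j /annihilatorP jJ; apply: dual_orthogonalK => x xW.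
  apply: jJ; apply: contraT => xC; case: nx; exists x => // a i a0 iJ.
  exact: ((dual_orthogonalP W x).1 xW _ (WP _ _ a0 iJ)).
have [l lg l1] := integral_of_weight gg we eg1 hJ.
have [l' l'1 l'E] := integral_translate gg lg.
have l'11 : ev l' 1 = 1 by rewrite l'E hmul1.
have [N [N0 Nstab NC]] := maschke l'1 l'11 (coradical_subcoalg H) ncoss.
have [m Jm] := radical_nilpotent H.
(* Induction on the power of [J] that kills [x]: a vector of [N] killed by [J] itself lies in H_0,
   hence is 0. With [J] nilpotent this gives [N = 0], the contradiction. *)
have socle k x : x \in N -> (forall j, j \in (J ^+ k)%VS -> ract s j x = 0) -> x = 0.
  elim: k x => [|k IHk] x xN xk.
    by apply: ev_sep => a; rewrite -[a](dmul1 s) -ev_ract xk ?memv_line // !ev0r.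
  have xJ j : j \in J -> ract s j x = 0.
    move=> jJ; apply: IHk => [|i iJ]; first exact: Nstab.
    have ij : i ∗ j \in (J ^+ k.+1)%VS.
      by rewrite /dmul; case: (s); [rewrite expvSl | rewrite expvSr]; apply: memv_mul.
    rewrite -[RHS](xk _ ij); apply: ev_sep => b.
    by rewrite !ev_ract dmulA.
  apply/eqP; rewrite -memv0 -NC memv_cap xN; apply: annihilatorK => j jJ.
  by rewrite -[j](d1mul s) -ev_ract xJ ?ev0r.
case/eqP: N0; apply/eqP; rewrite -subv0; apply/subvP => x xN; rewrite memv0.
apply/eqP; apply: (socle m) => // j; rewrite Jm memv0 => /eqP ->.
by apply: ev_sep => b; rewrite ev_ract dmul0r ev0l ev0r.
Qed.

Lemma P1_comp_neq0 g e : is_grouplike g -> is_weight g e -> ev e g = 1 ->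
  ~~ cosemisimple H -> exists2 y, y \in P1_comp g & y != 0.
Proof.
move=> gg we eg1 ncoss; have [x xC x0] := exists_extension gg we eg1 ncoss.
exists (x - qproj x); first exact: P1_comp_of.
by apply: contraNneq xC => /subr0_eq ->; apply: qproj_mem.
Qed.

End Component.
End Projection.

(** * Block decomposition of the coradical *)

Section Blocks.
Variable K : fieldType.
Implicit Types (C D : coalgType K) (m : nat).

Definition is_grp_functional C (E : 'Hom(C, K^o)) : Prop :=
  exists g : C, forall f,
    convolution f E = (f g : K) *: E /\ convolution E f = (f g : K) *: E.

Definition is_mx_functional C m (E : 'Hom(C, K^o)) : Prop :=
  exists d (e : 'I_d -> 'I_d -> 'Hom(C, K^o)) i0,
    [/\ (m <= d)%N,
        forall i j k l, convolution (e i j) (e k l) = (j == k)%:R *: e i l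
      & E = e i0 i0].

(* The dual algebra of C is a product of copies of K and of matrix algebras of
   size at least m; its unit is written as a sum of minimal idempotents. *)
Definition block_unit C m : Prop :=
  exists2 r : seq 'Hom(C, K^o), counit = \sum_(E <- r) E &
    forall E, E \in r -> is_grp_functional E \/ is_mx_functional m E.

Lemma convolution0l C (f : 'Hom(C, K^o)) : convolution 0 f = 0.
Proof.
have := (convolution_is_bilinear C).1 f 1 0 0; rewrite !scale1r addr0 => E.
by apply: (addrI (convolution 0 f)); rewrite -[LHS]E addr0.
Qed.

Lemma convolution0r C (f : 'Hom(C, K^o)) : convolution f 0 = 0.
Proof.
have := (convolution_is_bilinear C).2 f 1 0 0; rewrite !scale1r addr0 => E.
by apply: (addrI (convolution f 0)); rewrite -[LHS]E addr0.
Qed.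

Lemma grpcoalg_block_unit (T : finType) m : block_unit (grpcoalg K T) m.
Proof.
pose c t : 'Hom(grpcoalg K T, K^o) := linfun (fun x : grpcoalg K T => x t : K^o).
have cE t x : c t x = x t.
  pose f (x : grpcoalg K T) : K^o := x t.
  have lf : linear f by move=> k u v; rewrite /f !ffunE.
  pose L : {linear grpcoalg K T -> K^o} :=
    HB.pack f (GRing.isLinear.Build K (grpcoalg K T) K^o _ f lf).
  exact: (lfunE L).
have conv f t x : convolution f (c t) (grpcoalg_elt K x) =
     (f (grpcoalg_elt K x) : K) *: c t (grpcoalg_elt K x).
  by rewrite convolutionE -[comul]/(grpcoalg_comul K T) grpcoalg_comulE
    functional_tensorE.
have conv' f t x : convolution (c t) f (grpcoalg_elt K x) =
     (f (grpcoalg_elt K x) : K) *: c t (grpcoalg_elt K x).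
  rewrite convolutionE -[comul]/(grpcoalg_comul K T) grpcoalg_comulE functional_tensorE.
  exact: mulrC.
exists [seq c t | t : T].
  apply: grpcoalg_ext => x; rewrite -[counit]/(grpcoalg_counit K T) grpcoalg_counitE.
  rewrite big_map big_enum sum_lfunE (bigD1 x) //= cE ffunE eqxx.
  by rewrite big1 ?addr0 // => t tx; rewrite cE ffunE (negPf tx).
move=> E /mapP[t _ ->]; left; exists (grpcoalg_elt K t) => f.
have ctx x : (f (grpcoalg_elt K x) : K) *: c t (grpcoalg_elt K x) =
    (f (grpcoalg_elt K t) : K) *: c t (grpcoalg_elt K x).
  by rewrite cE ffunE; case: (eqVneq t x) => [->|] //; rewrite !scaler0.
by split; apply: grpcoalg_ext => x; rewrite ?conv ?conv' scale_lfunE ctx.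
Qed.

Lemma mxcoalg_block_unit n m : (m <= n)%N -> block_unit (mxcoalg K n) m.
Proof.
move=> mn; pose e i j : 'Hom(mxcoalg K n, K^o) := linfun (fun A : mxcoalg K n =>
  A i j : K^o).
have eE i j A : e i j A = A i j.
  pose f (x : mxcoalg K n) : K^o := x i j.
  have lf : linear f by move=> k u v; rewrite /f !mxE.
  pose L : {linear mxcoalg K n -> K^o} :=
    HB.pack f (GRing.isLinear.Build K (mxcoalg K n) K^o _ f lf).
  exact: (lfunE L).
exists [seq e i i | i : 'I_n].
  apply: mxcoalg_ext => i j; rewrite -[counit]/(mxcoalg_counit K n) mxcoalg_counitE.
  rewrite big_map big_enum sum_lfunE (bigD1 i) //= eE mxE eqxx /=.
  by rewrite big1 ?addr0 // => k ki; rewrite eE mxE (negPf ki).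
move=> E /mapP[i0 _ ->]; right; exists n, e, i0; split=> // i j k l.
apply: mxcoalg_ext => a b; rewrite scale_lfunE eE convolutionE.
rewrite -[comul]/(mxcoalg_comul K n) mxcoalg_comulE linear_sum /=.
under eq_bigr do rewrite functional_tensorE !eE !mxE.
rewrite mxE (bigD1 j) //= eqxx andbT big1 ?addr0 => [|r rj]; last first.
  by rewrite [j == r]eq_sym (negPf rj) andbF scale0r.
by rewrite [k == j]eq_sym; case: (i == a); case: (j == k); case: (l == b);
  rewrite ?scale1r ?scale0r ?scaler0.
Qed.

Lemma dsum_block_unit C D m :
  block_unit C m -> block_unit D m -> block_unit (dsum C D) m.
Proof.
move=> [r rE rP] [s sE sP].
pose i1 := dsum_inl C D; pose i2 := dsum_inr C D.
pose p1 := dsum_fst C D; pose p2 := dsum_snd C D.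
have F11 (F : 'Hom(C, K^o)) : ((F \o p1) \o i1 = F)%VF.
  by apply/lfunP => x; rewrite !comp_lfunE dsum_fstl.
have F12 (F : 'Hom(C, K^o)) : ((F \o p1) \o i2 = 0)%VF.
  by apply/lfunP => x; rewrite !comp_lfunE dsum_fstr linear0 zero_lfunE.
have F21 (F : 'Hom(D, K^o)) : ((F \o p2) \o i1 = 0)%VF.
  by apply/lfunP => x; rewrite !comp_lfunE dsum_sndl linear0 zero_lfunE.
have F22 (F : 'Hom(D, K^o)) : ((F \o p2) \o i2 = F)%VF.
  by apply/lfunP => x; rewrite !comp_lfunE dsum_sndr.
have ext (a b : 'Hom(dsum C D, K^o)) :
    (a \o i1 = b \o i1)%VF -> (a \o i2 = b \o i2)%VF -> a = b.
  move=> ab1 ab2; apply: dsum_ext => x.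
    by have /lfunP/(_ x) := ab1; rewrite !comp_lfunE.
  by have /lfunP/(_ x) := ab2; rewrite !comp_lfunE.
have M1 a b : (convolution a b \o i1)%VF = convolution (a \o i1)%VF (b \o i1)%VF.
  by rewrite (convolution_comp _ _ (@dsum_comull K C D)).
have M2 a b : (convolution a b \o i2)%VF = convolution (a \o i2)%VF (b \o i2)%VF.
  by rewrite (convolution_comp _ _ (@dsum_comulr K C D)).
have simp := (M1, M2, F11, F12, F21, F22, convolution0l, convolution0r,
  =^~ comp_lfunZl, scaler0).
exists ([seq (E \o p1)%VF | E <- r] ++ [seq (E \o p2)%VF | E <- s]).
  rewrite big_cat !big_map /= -[counit]/(dsum_counit C D) /dsum_counit rE sE.
  by apply/lfunP => x; rewrite !add_lfunE !comp_lfunE !sum_lfunE;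
    congr (_ + _); apply: eq_bigr => E _; rewrite comp_lfunE.
move=> E; rewrite mem_cat => /orP[] /mapP[F Fr ->].
  case: (rP F Fr) => [[g gP]|[d [e [i0 [md eM ->]]]]]; [left | right].
    exists (i1 g) => f; have [l l'] := gP (f \o i1)%VF; rewrite comp_lfunE in l l'.
    by split; apply: ext; rewrite !simp.
  exists d, (fun i j => (e i j \o p1)%VF), i0; split=> // i j k l.
  by apply: ext; rewrite !simp ?eM.
case: (sP F Fr) => [[g gP]|[d [e [i0 [md eM ->]]]]]; [left | right].
  exists (i2 g) => f; have [l l'] := gP (f \o i2)%VF; rewrite comp_lfunE in l l'.
  by split; apply: ext; rewrite !simp.
exists d, (fun i j => (e i j \o p2)%VF), i0; split=> // i j k l.
by apply: ext; rewrite !simp ?eM.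
Qed.

Lemma grp_mx_block_unit (T : finType) (ns : seq nat) m :
  (forall n, n \in ns -> (m <= n)%N) -> block_unit (grp_mx_coalg K T ns) m.
Proof.
rewrite /grp_mx_coalg; have := grpcoalg_block_unit T m.
elim: ns (grpcoalg K T : coalgType K) => [|n ns IHns] C //= CP nsP.
apply: IHns => [|k kns]; last by rewrite nsP // inE kns orbT.
by apply: dsum_block_unit CP _; apply: mxcoalg_block_unit; rewrite nsP ?mem_head.
Qed.

Lemma dim_grp_mx_coalg (T : finType) (ns : seq nat) :
  \dim {:grp_mx_coalg K T ns} = (#|T| + \sum_(n <- ns) n ^ 2)%N.
Proof.
rewrite /grp_mx_coalg; have -> : #|T| = \dim {:grpcoalg K T : coalgType K}.
  by rewrite dimvf /dim /= muln1.
elim: ns (grpcoalg K T : coalgType K) => [|n ns IHns] C /=;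
  first by rewrite big_nil addn0.
rewrite IHns big_cons addnA; congr (_ + _)%N.
by rewrite !dimvf /dim /= -mulnn.
Qed.

Lemma coalg_iso_dim C D : coalg_iso C D -> \dim {:C} = \dim {:D}.
Proof.
move=> [f [_ [g fK gK]]]; have f0 : lker f == 0%VS by apply/lker0P; apply: can_inj fK.
have <- : limg f = fullv.
  apply/vspaceP => y; rewrite memvf -[y]gK; exact: memv_img (memvf _).
by rewrite limg_dim_eq // (eqP f0) capv0.
Qed.

Lemma coalg_iso_block_unit C D m : coalg_iso C D -> block_unit D m -> block_unit C m.
Proof.
move=> [f [[fM f1] [g fK gK]]] [r rE rP].
have f0 : lker f == 0%VS by apply/lker0P; apply: can_inj fK.
have fV (a : 'Hom(C, K^o)) : a = ((a \o f^-1) \o f)%VF.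
  by rewrite -comp_lfunA lker0_compVf // comp_lfun1r.
exists [seq (E \o f)%VF | E <- r].
  rewrite big_map; apply/lfunP => x; rewrite -f1 rE !sum_lfunE.
  by apply: eq_bigr => E _; rewrite comp_lfunE.
move=> E /mapP[F Fr ->].
case: (rP F Fr) => [[h hP]|[d [e [i0 [md eM ->]]]]]; [left | right].
  exists (f^-1%VF h) => a; have [l l'] := hP (a \o f^-1)%VF.
  rewrite comp_lfunE in l l'.
  by rewrite {1 3}(fV a) !(convolution_comp _ _ fM) l l' !comp_lfunZl.
exists d, (fun i j => (e i j \o f)%VF), i0; split=> // i j k l.
by rewrite (convolution_comp _ _ fM) eM comp_lfunZl.
Qed.

End Blocks.

(** * Weights and matrix units in the dual algebra *)

Section Weights.
Variables (K : fieldType) (H : hopfType K).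
Variable p : 'Hom(H, coradical_coalg H).
Hypothesis p_proj : is_coradical_proj p.
Implicit Types (x y z g h : H) (a b c : dual H).
Local Notation J := (radical H).
Local Notation res := (res p).

Definition is_matrix_unit s m (E : dual H) : Prop :=
  exists d (e : 'I_d -> 'I_d -> dual H) i0,
    [/\ (m <= d)%N, forall i j, res (e i j) = e i j,
        forall i j k l, dmul s (e i j) (e k l) = (j == k)%:R *: e i l
      & E = e i0 i0].

(** Composition with the projection embeds (H_0)^* in [dual H] as an algebra fixed by [res], and
    carries the decomposition of the unit along. *)
Lemma dual_unit m : block_unit (coradical_coalg H) m ->
  exists2 r : seq (dual H), 1 = \sum_(E <- r) E &
    forall E, E \in r -> (exists h, is_weight p h E) \/ (forall s, is_matrix_unit s m
      E).
Proof.
move=> [r rE rP]; have pM := (proj1 (proj1 p_proj)); have p1 := proj2 (proj1 p_proj).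
have resp (F : 'Hom(coradical_coalg H, K^o)) : res (F \o p)%VF = (F \o p)%VF.
  by apply/lfunP => x; rewrite !comp_lfunE (proj2 p_proj).
have convp (F G : 'Hom(coradical_coalg H, K^o)) :
    ((F \o p)%VF : dual H) * (G \o p)%VF = (convolution F G \o p)%VF.
  exact: convolution_comp.
have resE a : res a = ((a \o coradical_incl H) \o p)%VF.
  by rewrite -comp_lfunA.
exists [seq ((F \o p)%VF : dual H) | F <- r].
  rewrite big_map; apply: ev_inj => x.
  rewrite ev_suml ev1 -p1 rE sum_lfunE.
  by apply: eq_bigr => F _; rewrite /ev comp_lfunE.
move=> E /mapP[F Fr ->].
case: (rP F Fr) => [[g gP]|[d [e [i0 [md eM ->]]]]]; [left | right].
  exists (coradical_incl H g); split=> // s a.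
  have [l l'] := gP (a \o coradical_incl H)%VF; rewrite comp_lfunE in l l'.
  have EE : ev a (coradical_incl H g) *: ((F \o p)%VF : dual H)
     = (((a (coradical_incl H g) : K) *: F) \o p)%VF by rewrite -comp_lfunZl.
  by rewrite EE resE /dmul; case: s; rewrite convp ?l ?l'.
have eS i j : res (e i j \o p)%VF = (e i j \o p)%VF by [].
have eMul i j k l : ((e i j \o p)%VF : dual H) * (e k l \o p)%VF =
    (j == k)%:R *: ((e i l \o p)%VF : dual H).
  by rewrite convp eM -comp_lfunZl.
case.
  (* For the reversed product the transposed family is a system of matrix units. *)
  exists d, (fun i j => (e j i \o p)%VF), i0; split=> // i j k l.
  by rewrite /dmul eMul eq_sym.
by exists d, (fun i j => (e i j \o p)%VF), i0; split=> // i j k l; apply: eMul.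
Qed.

(** The eigenvalue of [res a] on the nonzero vector [E] is multiplicative in [a], because [res]
    is. *)
Lemma weight_grouplike h E : is_weight p h E -> E != 0 -> is_grouplike h.
Proof.
move=> [_ /(_ false) hE] E0.
have inj (k l : K) : k *: E = l *: E -> k = l.
  move/eqP; rewrite -subr_eq0 -scalerBl scaler_eq0 (negPf E0) orbF subr_eq0.
  by move/eqP.
apply/is_grouplikeP; split=> [a b|].
  apply: inj; rewrite -hE resM // /dmul -mulrA -[res b * E]/(dmul false (res b) E) hE.
  by rewrite -scalerAr -[res a * E]/(dmul false (res a) E) hE scalerA mulrC.
by apply: inj; rewrite -hE res1 // d1mul scale1r.
Qed.

Lemma weight_eval g h E : is_weight p h E -> is_grouplike g -> ev E g != 0 -> g = h.
Proof.
move=> [_ /(_ false) hE] gg Eg; apply: ev_sep => a.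
have [gM _] := (is_grouplikeP g).1 gg.
have := congr1 (fun f => ev f g) (hE a);
  rewrite gM evZl ev_res_id ?grouplike_coradical //.
exact: mulIf.
Qed.

(** Some summand [E] of the unit is nonzero at [g]. It cannot be a matrix unit, so it is a weight,
    necessarily at [g], and it is rescaled. *)
Lemma exists_weight m g : (2 <= m)%N -> block_unit (coradical_coalg H) m ->
  is_grouplike g -> exists2 e, is_weight p g e & ev e g = 1.
Proof.
move=> m2 /dual_unit[r rE rP] gg; have [gM g1] := (is_grouplikeP g).1 gg.
have [E Er Eg] : exists2 E, E \in r & ev E g != 0.
  apply: contrapT => /forallPNP nE; move/eqP: g1; rewrite rE ev_suml big_seq big1.
    by rewrite eq_sym oner_eq0.
  by move=> E /nE; apply: contra_notP => /eqP.
have [[h wE]|/(_ false)[d [e [i0 [md _ eM EE]]]]] := rP E Er.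
  have gh := weight_eval wE gg Eg; exists ((ev E g)^-1 *: E);
    last by rewrite evZl mulVf.
  case: wE => resE hE; split.
    by apply: ev_inj => x; rewrite ev_res !evZl -ev_res resE.
  by move=> s a; rewrite dmulZr hE !scalerA mulrC gh.
(* A grouplike evaluates to zero on all of a matrix block of size at least 2. *)
have [j ji] : exists j : 'I_d, j != i0.
  apply: contrapT => /forallNP nj; have : (#|'I_d| <= 1)%N.
    apply/fintype_le1P => i k.
    by have /negP := nj i; have /negP := nj k; rewrite !negbK => /eqP-> /eqP->.
  by rewrite card_ord leqNgt (leq_trans m2 md).
have eij : ev (e i0 j) g = 0.
  have /(congr1 (fun f => ev f g)) := eM i0 j i0 j.
  by rewrite gM (negPf ji) scale0r ev0l => /eqP; rewrite mulf_eq0 orbb => /eqP.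
case/eqP: Eg; have /(congr1 (fun f => ev f g)) := eM i0 j j i0.
by rewrite gM eij mul0r eqxx scale1r -EE.
Qed.

Lemma ract_sum s r y : ract s (\sum_(E <- r) E) y = \sum_(E <- r) ract s E y.
Proof.
apply: ev_sep => b; rewrite ev_ract ev_sumr (big_morph (dmul s b) (dmulDr s b)
  (dmul0r s b)).
by rewrite ev_suml; apply: eq_bigr => E _; rewrite ev_ract.
Qed.

(** Some summand [E] of the unit moves [y] to a nonzero vector. It is not a weight by
    [P1_comp_weight], so it is a diagonal matrix unit, and the matrix units in its column move [y]
    to the required independent elements. *)
Lemma dim_P1_comp s m g y :
    (forall x, ~ @is_nontrivial_skew_primitive K H x) ->
    block_unit (coradical_coalg H) m -> is_grouplike g ->
    y \in P1_comp p s g -> y != 0 ->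
  (m <= \dim (P1_comp p s g))%N.
Proof.
move=> noskew /dual_unit[r rE rP] gg yP y0.
have [E Er Ey] : exists2 E, E \in r & ract s E y != 0.
  apply: contrapT => /forallPNP nE; case/eqP: y0; apply: ev_sep => a.
  rewrite -[a](dmul1 s) -ev_ract rE ract_sum big_seq big1 ?ev0r // => E /nE.
  by apply: contra_notP => /eqP.
have [[h wE]|/(_ s)[d [e [i0 [md eS eM EE]]]]] := rP E Er.
  have E0 : E != 0.
    apply: contraNneq Ey => ->; apply/eqP/ev_sep => b.
    by rewrite ev_ract dmul0r ev0l ev0r.
  case/eqP: Ey; apply: (P1_comp_weight p_proj noskew gg _ wE yP).
  exact: weight_grouplike wE E0.
rewrite (leq_trans md) //.
pose X := [tuple ract s (e j i0) y | j < d].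
have XE (j : 'I_d) : X`_j = ract s (e j i0) y by rewrite -tnth_nth tnth_mktuple.
have fX : free X.
  (* The action of [e i0 l] turns the [l]-th vector into [ract s E y] and kills the others. *)
  apply/freeP => k k0 l; have /(congr1 (ract s (e i0 l))) := k0.
  have lr := lin_ract s (e i0 l).
  rewrite (lin0 lr) -(linear_linfun lr) linear_sum (bigD1 l) //= big1 => [|j jl].
    rewrite addr0 linearZ /= linear_linfun // XE => /eqP.
    have -> : ract s (e i0 l) (ract s (e l i0) y) = ract s E y.
      by apply: ev_sep => b; rewrite !ev_ract -dmulA eM eqxx scale1r EE.
    by rewrite scaler_eq0 (negPf Ey) orbF => /eqP.
  rewrite linearZ /= linear_linfun // XE; apply: ev_sep => b.
  by rewrite evZr !ev_ract -dmulA eM eq_sym (negPf jl) scale0r dmul0r ev0l ev0r mulr0.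
have <- : \dim <<X>> = d by rewrite (eqP fX) size_tuple.
apply: dimvS; apply/span_subvP => z /(nthP 0)[j]; rewrite size_tuple => jd <-.
by rewrite -[j]/(val (Ordinal jd)) XE; apply: P1_comp_ract.
Qed.

End Weights.

(** * The first term of the coradical filtration *)

Section Filtration.
Variables (K : fieldType) (H : hopfType K).
Variable p : 'Hom(H, coradical_coalg H).
Hypothesis p_proj : is_coradical_proj p.
Implicit Types (x y z g h : H) (a b c : dual H).
Local Notation J := (radical H).
Local Notation res := (res p).
Local Notation q := (qproj p).

(** H_1 is the orthogonal of J^2. *)
Lemma mem_corad_filt1 x :
  (x \in corad_filt H 1) <-> (forall a b, a \in J -> b \in J -> ev (a * b) x = 0).
Proof.
rewrite /= -memv_preim; split=> [xH1 a b /annihilatorP aJ /annihilatorP bJ|x0].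
  suff /subvP/(_ _ xH1) : (tensv fullv (coradical H) + tensv (coradical H) fullv
      <= lker (functional_tensor a b))%VS by rewrite memv_ker evM => /eqP.
  rewrite subv_add; apply/andP; split; apply: tensvP => u v uC vC;
    rewrite memv_ker functional_tensorE.
    by rewrite -[fun_of_lfun b v]/(ev b v) bJ // scaler0.
  by rewrite -[fun_of_lfun a u]/(ev a u) aJ // scale0r.
(* This is the vanishing of (1 - q) ⊗ (1 - q) on the coproduct; the two terms lie in H ⊗ H_0 and H_0
   ⊗ H. *)
have -> : comul x = tmap \1 q (comul x) + tmap q (\1 - q)%VF (comul x).
  apply: functional_tensor_sep => a b; rewrite linearD /= !functional_tensor_tmap.
  rewrite comp_lfun1r; set b' := (b \o (\1 - q))%VF.
  have bE : b' = (b : dual H) - res b :> dual H.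
    by apply: ev_inj => y; rewrite evBl ev_res /ev comp_lfunE add_lfunE opp_lfunE
      id_lfunE linearB.
  have := x0 _ _ (sub_res_radical p_proj a) (sub_res_radical p_proj b).
  rewrite mulrBl evBl mulrBr evBl -bE !evM => /eqP; rewrite subr_eq0 => /eqP E.
  rewrite -[(a \o q)%VF]/(res a) -[(b \o q)%VF]/(res b) -E.
  by rewrite addrC subrK.
have mem1 (f g : 'End(H)) (C D : {vspace H}) (t : tens H H) :
    (forall y, f y \in C) -> (forall y, g y \in D) -> tmap f g t \in tensv C D.
  move=> fC gD; rewrite [t]tensor_basis !linear_sum; apply: rpred_sum => i _.
  rewrite linear_sum; apply: rpred_sum => j _.
  by rewrite linearZ rpredZ //= tmapE mem_tensv.
by apply: memv_add; apply: mem1 => y; rewrite ?memvf // qproj_mem.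
Qed.

Lemma corad_filt1 : corad_filt H 1 = (coradical H + P1 p)%VS.
Proof.
apply/eqP; rewrite eqEsubv; apply/andP; split.
  apply/subvP => x /mem_corad_filt1 x0; rewrite -[x](subrK (q x)) addrC.
  by rewrite memv_add ?qproj_mem //; apply: (P1_of p_proj (s := false)).
rewrite subv_add; apply/andP; split; apply/subvP => x.
  move=> xC; apply/mem_corad_filt1 => a b aJ bJ.
  have := radical_ideal 1 b aJ; rewrite mul1r => /annihilatorP; exact.
move=> /(dmul_P1 p false) xP; apply/mem_corad_filt1 => a b aJ bJ.
by have := xP a b; rewrite /dmul !res_radical // mul0r mulr0 ev0l addr0.
Qed.

Lemma dim_corad_filt1 : \dim (corad_filt H 1) = (\dim (coradical H) + \dim (P1 p))%N.
Proof.
rewrite corad_filt1 dimv_disjoint_sum //; apply/eqP; rewrite -subv0.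
apply/subvP => x /memv_capP[xC xP]; rewrite memv0; apply/eqP.
exact: (P1_coradical0 p_proj).
Qed.

Lemma corad_filt1_proper m : (2 <= m)%N -> block_unit (coradical_coalg H) m ->
    (forall x, ~ @is_nontrivial_skew_primitive K H x) -> ~~ cosemisimple H ->
  (\dim (corad_filt H 1) < \dim {:H})%N.
Proof.
move=> m2 blocks noskew ncoss; rewrite ltnNge; apply/negP => dimH1.
have /eqP H1 : corad_filt H 1 == fullv by rewrite eqEdim subvf.
have JJ a b x : a \in J -> b \in J -> ev (a * b) x = 0.
  by have := memvf x; rewrite -H1 => /mem_corad_filt1; apply.
have JJ0 a b : a \in J -> b \in J -> a * b = 0.
  by move=> aJ bJ; apply: ev_inj => x; rewrite JJ ?ev0l.
have J_mul a b : a \in J -> a * b \in J.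
  by move=> aJ; have := radical_ideal 1 b aJ; rewrite mul1r.
have J_mulr a b : a \in J -> b * a \in J.
  by move=> aJ; have := radical_ideal b 1 aJ; rewrite mulr1.
have g1 : is_grouplike (1 : H) by rewrite /is_grouplike comul1 counit1 !eqxx.
have [e1 we1 e11] := exists_weight p_proj m2 blocks g1.
(* With [true] the product is reversed: [x0] is killed by all [j * a] with [j] in [J] and [a]
   vanishing at 1. *)
have [x0 x0C x0J] := exists_extension p_proj true g1 we1 e11 ncoss.
have [j jJ jx0] : exists2 j, j \in J & ev j x0 != 0.
  apply: contrapT => /forallPNP nj; case/negP: x0C; apply: annihilatorK => a aJ.
  by apply/eqP; apply: contra_notT (nj a aJ).
(* As [e1 - 1] vanishes at 1, [lambda] and [j] agree at [x0]. The weight property of [e1] and J^2 =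
   0 make [lambda] an integral. *)
pose lambda := j * e1; have lJ : lambda \in J by apply: J_mul.
have l0 : lambda != 0.
  have := x0J (e1 - 1) j; rewrite evBl e11 ev1_1 subrr /dmul => /(_ erefl jJ).
  rewrite mulrBr mulr1 evBl => /eqP; rewrite subr_eq0 => /eqP lx0.
  by apply: contraNneq jx0 => l0; rewrite -lx0 -/lambda l0 ev0l.
have l1 : is_integral false 1 lambda.
  move=> b; rewrite /dmul /lambda -mulrA -{1}[b](subrK (res b)) mulrDr mulrDr.
  have [_ /(_ true b)] := we1; rewrite /dmul => ->.
  rewrite JJ0 ?add0r ?scalerAr //; apply: J_mulr; exact: (sub_res_radical p_proj).
have [x lx] : exists x, ev lambda x = 1.
  have [y ly] : exists y, ev lambda y != 0.
    apply: contrapT => /forallNP ly; case/eqP: l0; apply: ev_inj => y.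
    by rewrite ev0l; apply/eqP; apply: contra_notT (ly y).
  by exists ((ev lambda y)^-1 *: y); rewrite evZr mulVf.
(* By uniqueness each [b * lambda] is a multiple of [lambda]; evaluation at [x] identifies the
   factor as [ev b g], which is multiplicative in [b]. *)
pose g := ract false lambda x.
have gE b : b * lambda = ev b g *: lambda.
  have [|c bE] := integral_unique l1 l0 (_ : is_integral false 1 (b * lambda)).
    by move=> c; rewrite /dmul -mulrA [lambda * c]l1 -scalerAr.
  by rewrite /g ev_ract /dmul bE evZl lx mulr1.
have gg : is_grouplike g.
  apply/is_grouplikeP; split=> [a b|]; last by rewrite /g ev_ract d1mul.
  by rewrite {1}/g ev_ract /dmul -mulrA gE -scalerAr evZl -[ev (a * lambda)
    x](ev_ract false) mulrC.
clearbody g; have [e we eg] := exists_weight p_proj m2 blocks gg.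
have yP : x - q x \in P1 p.
  by apply: (P1_of p_proj (s := false)) => a b aJ bJ; apply: JJ.
have ly : ev lambda (x - q x) = 1.
  by rewrite -ev_sub_res // res_radical // subr0 lx.
have y1P : ract true e (x - q x) \in P1_comp p false g.
  have [rese eE] := we; apply/P1_compP; split; first exact: P1_ract.
  move=> a b; rewrite !ev_ract.
  have -> : dmul true (dmul false (res a) b) e = dmul true (res a) e * b by rewrite
    /dmul mulrA.
  by rewrite eE -scalerAl evZl.
(* [lambda] takes the value 1 on the vector said to vanish, since [lambda * e1] and [e * lambda] are
   both [lambda] and [lambda] is 1 at [x - q x]. *)
have := P1_comp_weight p_proj noskew gg g1 we1 y1P.
move/(congr1 (ev lambda)); rewrite ev0r ev_ract [dmul _ _ _]l1 evZl ev_ract.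
rewrite -[dmul _ _ _]/(e * lambda) gE evZl e11 eg ly !mulr1 => /eqP.
by rewrite oner_eq0.
Qed.

(** Each grouplike contributes two components of dimension at least [m], one for each side, and all
    of them are independent in [P1]. *)
Lemma dim_P1_ge m : (2 <= m)%N -> block_unit (coradical_coalg H) m ->
    (forall x, ~ @is_nontrivial_skew_primitive K H x) -> ~~ cosemisimple H ->
  (2 * m * #|` grouplikes H| <= \dim (P1 p))%N.
Proof.
move=> m2 blocks noskew ncoss.
pose I : finType := (bool * grouplikes H)%type.
pose V (i : I) := P1_comp p i.1 (val i.2).
have gP (i : I) : is_grouplike (val i.2) by rewrite -mem_grouplikes; apply: valP.
have dimV i : (m <= \dim (V i))%N.
  have [e we eg] := exists_weight p_proj m2 blocks (gP i).
  have [y yP y0] := P1_comp_neq0 p_proj i.1 (gP i) we eg ncoss.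
  exact: (dim_P1_comp p_proj noskew blocks (gP i) yP y0).
have dV : directv (\sum_i V i).
  apply/directv_sum_independent => u uV u0 i _.
  have [e we eg] := exists_weight p_proj m2 blocks (gP i).
  have lE := lin_ract (~~ i.1) e.
  (* The weight at the grouplike of [i] acts as the identity on component [i]. It vanishes at the
     other grouplikes, which kills the components of the same side; those of the other side are
     killed by [P1_comp_weight]. *)
  have Lu k : ract (~~ i.1) e (u k) = if k == i then u k else 0.
    have [-> | nki] := eqVneq.
      apply: ev_sep => b; rewrite ev_ract.
      have /P1_compP[_ /(_ e b)] := uV i isT; rewrite we.1 eg mul1r => <-.
      by congr ev; rewrite /dmul; case: i.1.
    have [k1|k1] := eqVneq k.1 i.1; last first.
      have k1' : k.1 = ~~ i.1 by move: k1; case: k.1; case: i.1.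
      rewrite -k1'; exact: (P1_comp_weight p_proj noskew (gP k) (gP i) we (uV k isT)).
    have ek : ev e (val k.2) = 0.
      apply/eqP; apply: contraT => ek; case/negP: nki.
      have /val_inj k2 := weight_eval p_proj we (gP k) ek.
      by apply/eqP; rewrite [k]surjective_pairing [i]surjective_pairing k1 k2.
    apply: ev_sep => b; rewrite ev_ract ev0r.
    have /P1_compP[_ /(_ e b)] := uV k isT; rewrite we.1 ek mul0r k1 => <-.
    by congr ev; rewrite /dmul; case: i.1.
  have := congr1 (ract (~~ i.1) e) u0; rewrite (lin0 lE) -(linear_linfun lE) linear_sum.
  rewrite (bigD1 i) //= linear_linfun // Lu eqxx big1 ?addr0 // => k ki.
  by rewrite linear_linfun // Lu (negPf ki).
have sV : (\sum_i V i <= P1 p)%VS.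
  by apply/subv_sumP => i _; apply/subvP => y /P1_compP[].
rewrite (leq_trans _ (dimvS sV)) // (directvP dV) /=.
have -> : (2 * m * #|` grouplikes H| = \sum_(i : I) m)%N.
  by rewrite sum_nat_const /I card_prod card_bool cardfE mulnAC.
by apply: leq_sum.
Qed.

End Filtration.

Theorem corollary5p3 (K : closedFieldType) (charK : [pchar K] =i pred0)
    (H : hopfType K) (H_ncoss : ~~ cosemisimple H)
    (t : nat) (t_gt0 : (0 < t)%N) (n : t.-tuple nat)
    (n_ge2 : forall i : 'I_t, (2 <= tnth n i)%N)
    (n_sorted : forall i j : 'I_t, (i <= j)%N -> (tnth n i <= tnth n j)%N)
    (H0_iso : coalg_iso (coradical_coalg H) (grp_mx_coalg K (grouplikes H) n))
    (H_noskew : forall x : H, ~ is_nontrivial_skew_primitive x)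
    (p : 'Hom(H, coradical_coalg H)) (p_proj : is_coradical_proj p) :
  [/\ (\dim (corad_filt H 1) < \dim {:H})%N,
      \dim (corad_filt H 1) = (\dim (coradical H) + \dim (P1 p))%N &
      (\dim (coradical H) + \dim (P1 p) >=
         (1 + 2 * tnth n (Ordinal t_gt0)) * #|` grouplikes H|
         + \sum_(i < t) tnth n i ^ 2)%N].
Proof.
set m := tnth n (Ordinal t_gt0); have m2 : (2 <= m)%N := n_ge2 _.
(* Sorting makes the first size [m] a lower bound for all block sizes. *)
have blocks : block_unit (coradical_coalg H) m.
  apply: coalg_iso_block_unit H0_iso _; apply: grp_mx_block_unit => k /tnthP[i ->].
  exact: n_sorted.
split; first exact: (corad_filt1_proper p_proj m2).
  exact: dim_corad_filt1.
have dimH0 : \dim (coradical H) = (#|` grouplikes H| + \sum_(i < t) tnth n i ^ 2)%N.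
  have := coalg_iso_dim H0_iso; rewrite dim_grp_mx_coalg big_tuple -cardfE => <-.
  by rewrite dimvf.
rewrite dimH0 mulnDl mul1n addnAC leq_add2l.
exact: dim_P1_ge.
Qed.
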